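(* On a nonempty, homogeneous, compact metric space of negative type, the uniform measure exists and is the Haar probability measure.
   Context: For a metric space $X = (X,d)$ and $t>0$, $tX$ is the set $X$ with the metric $t d$. A metric space $(X,d)$ is positive definite if for every finite sequence $x_1,\dots,x_m$ of distinct points the matrix $(e^{-d(x_i,x_j)})$ is positive definite; $X$ is of negative type if $tX$ is positive definite for every $t>0$. A metric space is homogeneous if its isometry group acts transitively on points. A nonempty homogeneous compact metric space has a unique isometry-invariant (Radon) probability measure, called its Haar probability measure. $P(X)$ is the set of (Radon) probability measures on $X$, with the weak* topology as a subset of the dual of $C(X)$. For a compact metric space $X=(X,d)$ and $\mu \in P(X)$, put $(K\mu)(x) = \int_X e^{-d(x,y)}\, d\mu(y)$. The diversity of order $q \in [0,\infty]$ of $\mu$ is $D_q^X(\mu) = \left( \int_X (K\mu)^{q-1}\, d\mu \right)^{1/(1-q)}$ for $q \neq 1,\infty$; $D_1^X(\mu) = \exp\left(-\int_X \log(K\mu)\, d\mu\right)$; $D_\infty^X(\mu) = 1/\operatorname{ess\,sup}_\mu K\mu$. A probability measure $\mu$ on $X$ is maximising if for every $q \in [0,\infty]$ it maximises $D_q^X$ over $P(X)$. The maximising measures on $tX$ are those defined with respect to the metric $td$ (kernel $e^{-t d(x,y)}$), regarded as probability measures on the fixed set $X$. Uniform measure: suppose that $tX$ has a unique maximising measure $\mu_t$ for all sufficiently large $t$, and that $\lim_{t\to\infty}\mu_t$ exists in $P(X)$. Then the uniform measure on $X$ is said to exist, and it is $\mu_X = \lim_{t\to\infty}\mu_t$. 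*)

(* Defs.v *)
From HB Require Import structures.
From mathcomp Require Import all_boot all_order all_algebra.
From mathcomp Require Import all_classical all_reals all_analysis.
From mathcomp Require Import ess_sup_inf giry.

Set Implicit Arguments.
Unset Strict Implicit.
Unset Printing Implicit Defensive.

Import Order.TTheory GRing.Theory Num.Theory.
Import numFieldNormedType.Exports.

Local Open Scope classical_set_scope.
Local Open Scope ring_scope.

(* Nonempty metric spaces. The base point only records nonemptiness, in the
   form required by measurableType; no definition below refers to it. *)
#[short(type="pmetricType")]
HB.structure Definition PointedMetric (K : numDomainType) :=
  {M of Metric K M & Pointed M}.

Notation borel X := (g_sigma_algebraType (@open X)).

(* On a compact metric space every Borel probability measure is Radon, so no
   regularity condition is imposed. A measure is a function on all subsets of
   X which is unconstrained on the non-Borel ones: equality of measures must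
   therefore be read as measure_eq (notation ≡μ), agreement on Borel sets. *)
Notation prob R X := (probability (borel X) R).

(* prob R X as a subspace of the dual of C(X) with its weak* topology, i.e.
   the coarsest topology making each evaluation mu |-> \int[mu] f continuous. *)
Definition pairing (R : realType) (X : ptopologicalType) (mu : prob R X) :
    {ptws (continuousType X R) -> R} :=
  fun f => \int[mu]_x f x.

Notation weak_star R X := (initial_topology (@pairing R X)).

Section diversity.
Context {R : realType} {X : ptopologicalType}.
Implicit Types (d : X -> X -> R) (mu nu : prob R X).

Definition similarity d mu (x : X) : R := \int[mu]_y expR (- d x y).

(* The value at q = -oo is irrelevant: only q >= 0 is ever used. *)
Definition diversity d (q : \bar R) mu : R :=
  match q with
  | r%:E => if r == 1 then expR (- \int[mu]_x ln (similarity d mu x))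
            else (\int[mu]_x (similarity d mu x `^ (r - 1))) `^ (1 - r)^-1
  | +oo%E => (fine (ess_sup mu (fun x => (similarity d mu x)%:E)))^-1
  | -oo%E => 0
  end.

Definition maximising d mu :=
  forall q : \bar R, (0 <= q)%E -> forall nu, diversity d q nu <= diversity d q mu.

Definition unique_maximising d mu :=
  maximising d mu /\ forall nu, maximising d nu -> nu ≡μ mu.

End diversity.

Section metric_notions.
Context {R : realType}.

Definition posdefmx (m : nat) (A : 'M[R]_m) :=
  A^T = A /\ forall v : 'rV[R]_m, v != 0 -> 0 < (v *m A *m v^T) 0 0.

Definition positive_definite (T : Type) (d : T -> T -> R) :=
  forall (m : nat) (x : 'I_m -> T), injective x ->
    posdefmx (\matrix_(i, j) expR (- d (x i) (x j))).

(* The metric of tX; for t > 0 it induces the same topology as X, hence the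
   same Borel sets and the same space of measures. *)
Definition scaled_dist (X : metricType R) (t : R) : X -> X -> R :=
  fun x y => t * mdist x y.

Definition negative_type (X : metricType R) :=
  forall t : R, 0 < t -> positive_definite (@scaled_dist X t).

Definition self_isometry (X : metricType R) (g : X -> X) :=
  bijective g /\ forall x y, mdist (g x) (g y) = mdist x y.

Definition homogeneous (X : metricType R) :=
  forall x y : X, exists2 g : X -> X, self_isometry g & g x = y.

Context {X : pmetricType R}.
Implicit Types mu nu : prob R X.

Definition isometry_invariant mu :=
  forall g : X -> X, self_isometry g ->
    forall A : set (borel X), measurable A -> mu (g @^-1` A) = mu A.

Definition is_haar mu :=
  isometry_invariant mu /\ forall nu, isometry_invariant nu -> nu ≡μ mu.

Definition is_uniform_measure mu :=
  exists mu_ : R -> prob R X,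
    (\forall t \near +oo, unique_maximising (@scaled_dist X t) (mu_ t)) /\
    mu_ t @[t --> +oo] --> (mu : weak_star R X).

End metric_notions.

(* Main.v *)
(** The Haar measure [mu] has, for every [t], a constant similarity function, say
    of value [c], so all its diversities at scale [t] equal [1 / c].  For any
    [nu], writing [f] for the inverse of the similarity function of [nu] and
    [rho] for the integral of [f], positive definiteness applied to
    [f nu - rho mu] yields [rho <= 1 / c]; this is the case [q = 0], and the
    other orders follow from monotonicity of power means.  So [mu] maximises
    every diversity.

    If [nu] also does, the case [q = 2] shows that [s := nu - mu] has energy 0
    for [exp (- t d)].  In a space of negative type the densities [f] such that
    [f s] has energy 0 are stable under multiplication by
    [mdist ^~ z - mdist ^~ y], hence (by a lattice argument) by every Lipschitz
    function, and therefore [s = 0].  The same argument shows that the Haar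
    measure is unique.

    The Haar measure is obtained from the outer measure attached to an
    ultrafilter limit of the ratios of covering numbers [N_e(A) / N_e(X)]. *)
Require Import Defs.
From HB Require Import structures.
From mathcomp Require Import all_boot all_order all_algebra.
From mathcomp Require Import all_classical all_reals all_analysis.
From mathcomp Require Import measurable_realfun ess_sup_inf giry ring lra.

Set Implicit Arguments.
Unset Strict Implicit.
Unset Printing Implicit Defensive.

Import Order.TTheory GRing.Theory Num.Theory.
Import numFieldNormedType.Exports.

Local Open Scope classical_set_scope.
Local Open Scope ring_scope.

(** * Positive kernels *)

(** The obstacle is that strict positivity on finite sets gives only semidefiniteness on measures:
    energy 0 does not by itself kill a signed measure. Uniqueness therefore draws on the kernels at
    other scales, through [gromov], which is a limit of small scales, and through the derivative of
    the energy in the scale. All functions integrated against the kernels are Lipschitz. This class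
    contains the distance and the kernels, is closed under the operations needed and determines a
    Borel probability measure; its integrals are approximated by finite sums with an error linear in
    the mesh. Facts about finite sums thus pass to double integrals without product measures. *)

Section positive_kernels.
Context {R : realType} {T : Type}.
Implicit Types (k l : T -> T -> R) (s : seq (T * R)).

Definition kform k s := \sum_(p <- s) \sum_(q <- s) p.2 * q.2 * k p.1 q.1.

(** A weighted list, in which points may repeat, stands for a discrete signed measure; repetitions
    are merged only in [psd_positive_definite]. *)
Definition psd k := (forall x y, k x y = k y x) /\ forall s, 0 <= kform k s.

Lemma eq_kform k l s : (forall x y, k x y = l x y) -> kform k s = kform l s.
Proof.
by move=> kl; apply: eq_bigr => p _; apply: eq_bigr => q _; rewrite kl.
Qed.

Lemma eq_psd k l : (forall x y, k x y = l x y) -> psd k -> psd l.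
Proof.
by move=> kl [ks kp]; split=> [x y|s]; rewrite -?kl // -(eq_kform _ kl).
Qed.

Lemma kform_cons k p s : (forall x y, k x y = k y x) ->
  kform k (p :: s) = p.2 ^+ 2 * k p.1 p.1
    + 2 * p.2 * (\sum_(q <- s) q.2 * k q.1 p.1) + kform k s.
Proof.
move=> ks; rewrite /kform big_cons [X in X + _]big_cons.
under [X in _ + X = _]eq_bigr => q _ do rewrite big_cons.
rewrite big_split /= addrA -expr2 -[X in X + _ = _]addrA; congr (_ + _ + _).
rewrite mulr_sumr -big_split/=; apply: eq_bigr => q _.
by rewrite (ks p.1 q.1); ring.
Qed.

Lemma kformD k l s : kform (fun x y => k x y + l x y) s = kform k s + kform l s.
Proof.
rewrite /kform -big_split; apply: eq_bigr => p _ /=.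
by rewrite -big_split; apply: eq_bigr => q _ /=; rewrite mulrDr.
Qed.

Lemma kformZ (a : R) k s : kform (fun x y => a * k x y) s = a * kform k s.
Proof.
rewrite /kform mulr_sumr; apply: eq_bigr => p _ /=.
by rewrite mulr_sumr; apply: eq_bigr => q _ /=; rewrite mulrCA.
Qed.

Lemma kform_weight k (f : T -> R) s : kform (fun x y => f x * f y * k x y) s =
  kform k [seq (p.1, p.2 * f p.1) | p <- s].
Proof.
rewrite /kform big_map; apply: eq_bigr => p _; rewrite big_map.
by apply: eq_bigr => q _ /=; ring.
Qed.

Lemma kform_rank1 (f : T -> R) s :
  kform (fun x y => f x * f y) s = (\sum_(p <- s) p.2 * f p.1) ^+ 2.
Proof.
rewrite /kform expr2 mulr_suml; apply: eq_bigr => p _.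
by rewrite mulr_sumr; apply: eq_bigr => q _; ring.
Qed.

Lemma psd_weight k (f : T -> R) : psd k -> psd (fun x y => f x * f y * k x y).
Proof.
move=> [ks kp]; split=> [x y|s]; first by rewrite ks (mulrC (f x)).
by rewrite kform_weight.
Qed.

Lemma psd_diag k x : psd k -> 0 <= k x x.
Proof.
by move=> [_ /(_ [:: (x, 1)])]; rewrite /kform !big_seq1/= !mul1r.
Qed.

(** By [Q], adding [y] with any weight [c] keeps the form nonnegative. The minimum over [c], reached
    at [- b / k y y], is the claim divided by [k y y]. *)
Lemma psd_complement k y : psd k ->
  psd (fun x x' => k y y * k x x' - k x y * k x' y).
Proof.
move=> pk; have [ks kp] := pk; split=> [x x'|s].
  by rewrite (ks x) [X in _ - X]mulrC.
pose b := \sum_(q <- s) q.2 * k q.1 y.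
have -> : kform (fun x x' => k y y * k x x' - k x y * k x' y) s =
    k y y * kform k s - b ^+ 2.
  rewrite -(kform_rank1 (k^~ y)) -kformZ -[X in _ - X]mul1r -mulNr -kformZ -kformD.
  by apply: eq_kform => x x' /=; rewrite mulN1r.
have Q c : 0 <= c ^+ 2 * k y y + 2 * c * b + kform k s.
  by have := kp ((y, c) :: s); rewrite kform_cons.
have := psd_diag y pk; rewrite le_eqVlt => /predU1P[a0|a0].
  have [->|b0] := eqVneq b 0; first by rewrite -a0 mul0r expr0n subrr.
  (* With [k y y = 0] the polynomial is affine in [c], and this [c] would give it the value -1. *)
  have := Q (- (kform k s + 1) / (2 * b)); rewrite -a0 mulr0 add0r.
  have -> : 2 * (- (kform k s + 1) / (2 * b)) * b + kform k s = -1 by field.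
  by rewrite oppr_ge0 ler10.
have := Q (- b / k y y); rewrite -(pmulr_rge0 _ a0).
by congr (_ <= _); field; rewrite gt_eqF.
Qed.

Lemma kform_cons0 k p s : (forall x y, k x y = k y x) ->
  (forall x, k x p.1 = 0) -> kform k (p :: s) = kform k s.
Proof.
move=> ks k0; rewrite kform_cons// k0 mulr0 add0r big1 ?mulr0 ?add0r// => q _.
by rewrite k0 mulr0.
Qed.

(* Schur product: splitting off [k _ y * k _ y / k y y] leaves a positive kernel
   vanishing at [y], so that [y] can be removed from the list of points. *)
Lemma psdM k l : psd k -> psd l -> psd (fun x y => k x y * l x y).
Proof.
move=> pk [ls lp]; split=> [x y|s]; first by rewrite ls (proj1 pk).
elim: s k pk => [|p s IH] k pk; first by rewrite /kform big_nil.
have [ks _] := pk; pose y := p.1.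
have pc := psd_complement y pk.
have := psd_diag y pk; rewrite le_eqVlt => /predU1P[a0|a0].
  (* A zero diagonal entry kills its column: the complement at [(x, x)] is minus the square of
     [k x y]. *)
  have k0 x : k x y = 0.
    have := psd_diag x pc; rewrite -a0 mul0r sub0r oppr_ge0 -expr2 => h.
    by apply/eqP; rewrite -sqrf_eq0 eq_le h sqr_ge0.
  by rewrite kform_cons0 ?IH//= => [x x'|x]; rewrite ?k0 ?mul0r// ks ls.
rewrite -(pmulr_rge0 _ a0) -kformZ.
rewrite (@eq_kform _ (fun x x' => (k y y * k x x' - k x y * k x' y) * l x x'
   + k x y * k x' y * l x x')); last by move=> x x'; ring.
rewrite kformD kform_weight addr_ge0 ?lp// kform_cons0 ?IH// => [x x'|x].
  by rewrite (proj1 pc) ls.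
by rewrite [X in X - _]mulrC subrr mul0r.
Qed.

End positive_kernels.

(** * Lipschitz functions and their integrals *)

Section lipschitz.
Context {R : realType} {T : Type} (dd : T -> T -> R).
Implicit Types f g : T -> R.

(** [dd] is left arbitrary because the notion serves both on [X] and, with [dist2], on pairs. *)
Definition lip_with (l : R) f := forall x y, `|f x - f y| <= l * dd x y.

Definition lip f := exists2 l, 0 <= l & lip_with l f.

Lemma eq_lip f g : f =1 g -> lip f -> lip g.
Proof. by move=> fg [l l0 lf]; exists l => // x y; rewrite -!fg. Qed.

Lemma lipD f g : lip f -> lip g -> lip (fun x => f x + g x).
Proof.
move=> [l l0 lf] [m m0 mg]; exists (l + m); first exact: addr_ge0.
by move=> x y; rewrite opprD addrACA mulrDl (le_trans (ler_normD _ _))// lerD.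
Qed.

Lemma lipZ (a : R) f : lip f -> lip (fun x => a * f x).
Proof.
move=> [l l0 lf]; exists (`|a| * l); first exact: mulr_ge0.
by move=> x y; rewrite -mulrBr normrM -mulrA ler_wpM2l.
Qed.

Lemma lipN f : lip f -> lip (fun x => - f x).
Proof. by move/(lipZ (-1)); apply: eq_lip => x; rewrite mulN1r. Qed.

Lemma lipB f g : lip f -> lip g -> lip (fun x => f x - g x).
Proof. by move=> lf lg; apply/lipD/lipN. Qed.

Lemma lip_norm f : lip f -> lip (fun x => `|f x|).
Proof.
by move=> [l l0 lf]; exists l => // x y; rewrite (le_trans (ler_dist_dist _ _)).
Qed.

Hypothesis dd_ge0 : forall x y, 0 <= dd x y.

Lemma lip_cst (a : R) : lip (fun=> a).
Proof. by exists 0 => // x y; rewrite subrr normr0 mul0r. Qed.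

Lemma lip_inv m f : 0 < m -> (forall x, m <= f x) -> lip f ->
  lip (fun x => (f x)^-1).
Proof.
move=> m0 mf [l l0 lf]; exists (m ^- 2 * l).
  by rewrite mulr_ge0// invr_ge0 sqr_ge0.
move=> x y; have f0 z : 0 < f z := lt_le_trans m0 (mf z).
have -> : (f x)^-1 - (f y)^-1 = (f x * f y)^-1 * (f y - f x).
  by field; rewrite !gt_eqF.
rewrite normrM -mulrA distrC ler_pM// normfV normrM !gtr0_norm//.
by rewrite lef_pV2 ?posrE ?mulr_gt0 ?exprn_gt0// expr2 ler_pM// ltW.
Qed.

Variables (x0 : T) (D : R).
Hypothesis ddD : forall x y, dd x y <= D.

Lemma lip_bounded f : lip f -> exists2 M, 0 <= M & forall x, `|f x| <= M.
Proof.
move=> [l l0 lf]; exists (`|f x0| + l * D).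
  by rewrite addr_ge0// mulr_ge0// (le_trans _ (ddD x0 x0)).
move=> x; rewrite -[f x](subrK (f x0)) (le_trans (ler_normD _ _))//.
by rewrite addrC lerD// (le_trans (lf _ _))// ler_wpM2l.
Qed.

Lemma lipM f g : lip f -> lip g -> lip (fun x => f x * g x).
Proof.
move=> Lf Lg; have [M M0 fM] := lip_bounded Lf; have [N N0 gN] := lip_bounded Lg.
case: Lf Lg => [l l0 lf] [m m0 mg]; exists (M * m + N * l).
  by rewrite addr_ge0 ?mulr_ge0.
move=> x y; have -> : f x * g x - f y * g y =
  f x * (g x - g y) + g y * (f x - f y) by ring.
rewrite (le_trans (ler_normD _ _))// !normrM mulrDl -!mulrA.
by rewrite lerD// ler_pM.
Qed.

Lemma lip_expR f : lip f -> lip (fun x => expR (f x)).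
Proof.
move=> Lf; have [M M0 fM] := lip_bounded Lf; case: Lf => l l0 lf.
exists (expR M * l); first by rewrite mulr_ge0// expR_ge0.
have H u v : u <= M -> expR u - expR v <= expR M * `|u - v|.
  move=> uM; apply: (@le_trans _ _ (expR u * (u - v))); last first.
    apply: (@le_trans _ _ (expR u * `|u - v|)).
      by rewrite ler_wpM2l ?expR_ge0 ?ler_norm.
    by rewrite ler_wpM2r// ler_expR.
  have -> : expR v = expR u * expR (v - u) by rewrite -expRD addrC subrK.
  rewrite -[X in X - _]mulr1 -mulrBr ler_wpM2l ?expR_ge0//.
  by have := expR_ge1Dx (v - u); lra.
have fM' z : f z <= M := le_trans (ler_norm _) (fM z).
move=> x y; apply: (@le_trans _ _ (expR M * `|f x - f y|)).
  by rewrite ler_norml H// andbT lerNl opprB distrC H.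
by rewrite -mulrA ler_wpM2l ?expR_ge0.
Qed.

End lipschitz.

Lemma ler_linear_error {R : realFieldType} (a b c : R) : 0 <= c ->
  (forall e, 0 < e -> a <= b + c * e) -> a <= b.
Proof.
move=> c0 h; apply/ler_addgt0Pr => e e0.
have c1 : 0 < c + 1 by rewrite ltr_wpDl.
rewrite (le_trans (h (e / (c + 1)) _)) ?divr_gt0// lerD2l mulrA ler_pdivrMr//.
by rewrite mulrC ler_pM2l// lerDl.
Qed.

Lemma eq_linear_error {R : realFieldType} (a c : R) : 0 <= c ->
  (forall e, 0 < e -> `|a| <= c * e) -> a = 0.
Proof.
move=> c0 h; apply/eqP; rewrite -normr_le0; apply: (ler_linear_error c0) => e e0.
by rewrite add0r h.
Qed.

(** * Functionals approximated by finite sums *)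

Section tame.
Context {R : realType} {X : pmetricType R}.
Implicit Types (L : (X -> R) -> R) (f g : X -> R) (s : seq (X * R)).

Notation lip1 := (lip (@mdist R X)).
Notation lipw := (lip_with (@mdist R X)).

Definition wsum s f := \sum_(p <- s) p.2 * f p.1.

Definition weight s := \sum_(p <- s) `|p.2|.

Definition dist2 (p q : X * X) := mdist p.1 q.1 + mdist p.2 q.2.

Notation lip2 k := (lip dist2 (fun p => k p.1 p.2)).

(* Discrete approximation at scale [d], uniform over Lipschitz functions: it
   transfers finite-sum facts (positivity, Fubini) to integrals. *)
Definition tame C L := forall d, 0 < d -> exists s, weight s <= C /\
  forall l f, 0 <= l -> lipw l f -> `|L f - wsum s f| <= C * (l * d).

Lemma wsumB s f g : wsum s (fun x => f x - g x) = wsum s f - wsum s g.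
Proof.
by rewrite /wsum -sumrB; apply: eq_bigr => p _; rewrite mulrBr.
Qed.

Lemma wsum_le s f M : (forall x, `|f x| <= M) -> `|wsum s f| <= weight s * M.
Proof.
move=> fM; rewrite (le_trans (ler_norm_sum _ _ _))// mulr_suml ler_sum// => p _.
by rewrite normrM ler_wpM2l.
Qed.

Lemma weight_ge0 s : 0 <= weight s.
Proof. exact: sumr_ge0. Qed.

Lemma tame_ge0 C L : tame C L -> 0 <= C.
Proof. by move=> /(_ 1 ltr01)[s [sC _]]; exact: le_trans (weight_ge0 s) sC. Qed.

Lemma tameD C1 C2 L1 L2 : tame C1 L1 -> tame C2 L2 ->
  tame (C1 + C2) (fun f => L1 f + L2 f).
Proof.
move=> t1 t2 d d0; have [s1 [w1 h1]] := t1 d d0; have [s2 [w2 h2]] := t2 d d0.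
exists (s1 ++ s2); split; first by rewrite /weight big_cat lerD.
move=> l f l0 lf; rewrite /wsum big_cat/= opprD addrACA mulrDl.
by rewrite (le_trans (ler_normD _ _))// lerD ?h1 ?h2.
Qed.

Lemma tameZ C L a : tame C L -> tame (`|a| * C) (fun f => a * L f).
Proof.
move=> t d d0; have [s [w h]] := t d d0.
exists [seq (p.1, a * p.2) | p <- s]; split.
  rewrite /weight big_map/=; under eq_bigr do rewrite normrM.
  by rewrite -mulr_sumr ler_wpM2l.
move=> l f l0 lf; rewrite /wsum big_map/=; under eq_bigr do rewrite -mulrA.
by rewrite -mulr_sumr -mulrBr normrM -mulrA ler_wpM2l// h.
Qed.

(** Linearity on Lipschitz functions is inherited from the sums [wsum s], since one [s] approximates
    [L] at all three functions at once. *)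
Lemma tame_lin C L (a : R) f g : tame C L -> lip1 f -> lip1 g ->
  L (fun x => a * f x + g x) = a * L f + L g.
Proof.
move=> t Lf Lg; have C0 := tame_ge0 t.
have [m m0 mh] := lipD (lipZ a Lf) Lg.
case: Lf Lg => [l l0 lf] [n n0 ng].
apply/eqP; rewrite -subr_eq0; apply/eqP.
apply: (@eq_linear_error _ _ (C * m + `|a| * (C * l) + C * n)).
  by rewrite !addr_ge0// ?mulr_ge0// mulr_ge0.
move=> d d0; have [s [_ h]] := t d d0.
have -> : L (fun x => a * f x + g x) - (a * L f + L g) =
  (L (fun x => a * f x + g x) - wsum s (fun x => a * f x + g x))
  - a * (L f - wsum s f) - (L g - wsum s g).
  have -> : wsum s (fun x => a * f x + g x) = a * wsum s f + wsum s g.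
    rewrite /wsum mulr_sumr -big_split; apply: eq_bigr => p _ /=.
    by rewrite mulrDr mulrCA.
  by ring.
rewrite (le_trans (ler_normB _ _))// mulrDl lerD//; last by rewrite -mulrA h.
rewrite (le_trans (ler_normB _ _))// mulrDl lerD//; first by rewrite -mulrA h.
by rewrite normrM -!mulrA ler_wpM2l// h.
Qed.

Lemma lip1_cst (a : R) : lip1 (fun=> a).
Proof. exact: lip_cst. Qed.

Lemma tame0 C L : tame C L -> L (fun=> 0) = 0.
Proof.
move=> t; have := tame_lin 1 t (lip1_cst 0) (lip1_cst 0).
have -> : (fun=> 1 * 0 + 0 : R) = (fun=> 0) :> (X -> R).
  by apply/funext => x; rewrite mulr0 addr0.
by rewrite mul1r => h; apply: (addrI (L (fun=> 0))); rewrite -h addr0.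
Qed.

Lemma tame_D C L f g : tame C L -> lip1 f -> lip1 g ->
  L (fun x => f x + g x) = L f + L g.
Proof.
move=> t Lf Lg; rewrite -[in RHS](mul1r (L f)) -(tame_lin _ t)//.
by congr L; apply/funext => x; rewrite mul1r.
Qed.

Lemma tame_Z C L (a : R) f : tame C L -> lip1 f ->
  L (fun x => a * f x) = a * L f.
Proof.
move=> t Lf; rewrite -[RHS]addr0 -(tame0 t) -(tame_lin _ t)//; last exact: lip1_cst.
by congr L; apply/funext => x; rewrite addr0.
Qed.

Lemma tame_B C L f g : tame C L -> lip1 f -> lip1 g ->
  L (fun x => f x - g x) = L f - L g.
Proof.
move=> t Lf Lg; rewrite (tame_D t)//; last exact: lipN.
by rewrite -[in RHS]mulN1r -(tame_Z _ t)//; congr (_ + L _);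
  apply/funext => x; rewrite mulN1r.
Qed.

Lemma tame_le C L f M : tame C L -> lip1 f -> (forall x, `|f x| <= M) ->
  `|L f| <= C * M.
Proof.
move=> t [l l0 lf] fM; have C0 := tame_ge0 t.
have M0 : 0 <= M := le_trans (normr_ge0 _) (fM (point : X)).
apply: (@ler_linear_error _ _ _ (C * l)); first exact: mulr_ge0.
move=> d d0; have [s [wC h]] := t d d0.
rewrite -[L f](subrK (wsum s f)) (le_trans (ler_normD _ _))// addrC lerD//.
  by rewrite (le_trans (wsum_le _ fM))// ler_wpM2r.
by rewrite -mulrA h.
Qed.

Lemma lip2_swap k : lip2 k -> lip2 (fun x y => k y x).
Proof.
move=> [l l0 lk]; exists l => // p q.
by have := lk (p.2, p.1) (q.2, q.1); rewrite /dist2/= [in X in _ <= X]addrC.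
Qed.

Lemma lip2_l k y : lip2 k -> lip1 (k^~ y).
Proof.
move=> [l l0 lk]; exists l => // x x'.
by have := lk (x, y) (x', y); rewrite /dist2/= mdistxx addr0.
Qed.

Lemma lip2_r k x : lip2 k -> lip1 (k x).
Proof. by move/lip2_swap/(lip2_l x). Qed.

Lemma tame_kernel C L k l : tame C L -> 0 <= l ->
  lip_with dist2 l (fun p => k p.1 p.2) ->
  lipw (C * l) (fun x => L (k x)).
Proof.
move=> t l0 lk x x'.
have lk2 : lip2 k by exists l.
rewrite -(tame_B t); [|exact: lip2_r|exact: lip2_r].
rewrite -mulrA; apply: (tame_le t); first by apply: lipB; exact: lip2_r.
by move=> y; have := lk (x, y) (x', y); rewrite /dist2/= mdistxx addr0.
Qed.

Lemma lip_tame_kernel C L k : tame C L -> lip2 k -> lip1 (fun x => L (k x)).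
Proof.
move=> t [l l0 lk]; exists (C * l); last exact: tame_kernel.
by rewrite mulr_ge0// (tame_ge0 t).
Qed.

(** The outer functional is discretised first, the inner one next; each costs at most
    [C1 * C2 * l * d]. The lists are arguments so that [tame_Fubini] can use the same two in both
    orders. *)
Lemma double_approx C1 C2 L1 L2 k l : tame C1 L1 -> tame C2 L2 -> 0 <= l ->
  lip_with dist2 l (fun p => k p.1 p.2) -> forall d s1 s2,
  (weight s1 <= C1 /\
    forall m f, 0 <= m -> lipw m f -> `|L1 f - wsum s1 f| <= C1 * (m * d)) ->
  (weight s2 <= C2 /\
    forall m f, 0 <= m -> lipw m f -> `|L2 f - wsum s2 f| <= C2 * (m * d)) ->
  0 < d ->
  `|L1 (fun x => L2 (k x)) - wsum s1 (fun x => wsum s2 (k x))|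
    <= 2 * C1 * C2 * l * d.
Proof.
move=> t1 t2 l0 lk d s1 s2 [w1 h1] [w2 h2] d0.
have C10 := tame_ge0 t1; have C20 := tame_ge0 t2.
rewrite -(subrKA (wsum s1 (fun x => L2 (k x)))) -wsumB.
have -> : 2 * C1 * C2 * l * d = C1 * (C2 * l * d) + C1 * (C2 * (l * d)) by ring.
rewrite (le_trans (ler_normD _ _))// lerD//.
  by apply: h1; [exact: mulr_ge0|exact: tame_kernel].
apply: (@le_trans _ _ (weight s1 * (C2 * (l * d)))); last first.
  by rewrite ler_wpM2r// !mulr_ge0// ltW.
apply: wsum_le => x; apply: h2 => // y y'.
by have := lk (x, y) (x, y'); rewrite /dist2/= mdistxx add0r.
Qed.

Lemma tame_Fubini C1 C2 L1 L2 k : tame C1 L1 -> tame C2 L2 -> lip2 k ->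
  L1 (fun x => L2 (k x)) = L2 (fun y => L1 (k^~ y)).
Proof.
move=> t1 t2 [l l0 lk]; have C10 := tame_ge0 t1; have C20 := tame_ge0 t2.
apply/eqP; rewrite -subr_eq0; apply/eqP.
apply: (@eq_linear_error _ _ (2 * C1 * C2 * l + 2 * C2 * C1 * l)).
  by rewrite addr_ge0// !mulr_ge0.
move=> d d0; have [s1 h1] := t1 d d0; have [s2 h2] := t2 d d0.
have lk' : lip_with dist2 l (fun p => k p.2 p.1).
  move=> p q; have := lk (p.2, p.1) (q.2, q.1).
  by rewrite /dist2/= [in X in _ <= X]addrC.
have e1 := double_approx t1 t2 l0 lk h1 h2 d0.
have e2 := @double_approx _ _ _ _ (fun y x => k x y) _ t2 t1 l0 lk' _ _ _ h2 h1 d0.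
have E : wsum s1 (fun x => wsum s2 (k x)) = wsum s2 (fun y => wsum s1 (k^~ y)).
  rewrite /wsum; under eq_bigr do rewrite mulr_sumr.
  rewrite exchange_big/=; apply: eq_bigr => q _; rewrite mulr_sumr.
  by apply: eq_bigr => p _; rewrite mulrCA.
rewrite -(subrKA (wsum s1 (fun x => wsum s2 (k x)))) mulrDl.
by rewrite (le_trans (ler_normD _ _))// lerD// distrC E.
Qed.

Lemma tame_psd C L k : tame C L -> lip2 k -> psd k ->
  0 <= L (fun x => L (k x)).
Proof.
move=> t [l l0 lk] [_ pk]; have C0 := tame_ge0 t.
apply: (@ler_linear_error _ _ _ (2 * C * C * l)); first by rewrite !mulr_ge0.
move=> d d0; have [s h] := t d d0.
have := double_approx t t l0 lk h h d0; rewrite ler_norml => /andP[+ _].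
have -> : wsum s (fun x => wsum s (k x)) = kform k s.
  rewrite /kform /wsum; apply: eq_bigr => p _; rewrite mulr_sumr.
  by apply: eq_bigr => q _; rewrite mulrA.
by have := pk s; lra.
Qed.

End tame.

(** * Integrals over a compact metric space *)

Section integration.
Context {R : realType} {X : pmetricType R}.
Hypothesis cX : compact [set: X].
Implicit Types (nu : prob R X) (f g : X -> R).

Notation lip1 := (lip (@mdist R X)).
Notation lipw := (lip_with (@mdist R X)).

Lemma open_ballm (x : X) (r : R) : open (ball x r).
Proof.
rewrite openE => y; rewrite ballEmdist/= => xy; apply/nbhs_ballP.
exists (r - mdist x y); first by rewrite /= subr_gt0.
move=> z; rewrite !ballEmdist/= => yz.
by rewrite (le_lt_trans (metric_triangle _ y _))// -ltrBrDl.
Qed.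

Lemma finite_net (e : R) : 0 < e ->
  exists s : seq X, forall x, exists2 y, y \in s & mdist y x < e.
Proof.
move=> e0; have := cX; rewrite compact_cover => /(_ X setT (fun x => ball x e)).
case=> [x _|x _|s _ hs]; first exact: open_ballm.
  by exists x => //; rewrite ballEmdist/= mdistxx.
exists (finmap.enum_fset s) => x; have [y ys] := hs x I; rewrite ballEmdist/= => yx.
by exists y.
Qed.

Lemma diameter : exists D : R, forall x y : X, mdist x y <= D.
Proof.
have [s hs] := finite_net ltr01.
pose M := \sum_(y <- s) mdist (point : X) y.
have H x : mdist (point : X) x <= M + 1.
  have [y ys yx] := hs x; rewrite (le_trans (metric_triangle _ y _))// lerD//.
    by rewrite /M (big_rem y)//= lerDl sumr_ge0// => z _; exact: mdist_ge0.
  exact: ltW.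
exists (M + 1 + (M + 1)) => x y.
by rewrite (le_trans (metric_triangle _ (point : X) _))// lerD// metric_sym.
Qed.

Lemma lip1_dist (z : X) : lip1 (mdist z).
Proof.
exists 1 => // x y; rewrite mul1r ler_norml.
have := metric_triangle z x y; have := metric_triangle z y x.
by rewrite (metric_sym y); lra.
Qed.

Lemma lip1_continuous f : lip1 f -> continuous f.
Proof.
move=> [l l0 lf] x; apply/cvgrPdist_lt => e e0.
have l1 : 0 < l + 1 by rewrite ltr_wpDl.
apply/nbhs_ballP; exists (e / (l + 1)); first by rewrite /= divr_gt0.
move=> y; rewrite ballEmdist/= ltr_pdivlMr// => xy.
rewrite (le_lt_trans (lf _ _))// (le_lt_trans _ xy)// mulrC.
by rewrite ler_wpM2l ?mdist_ge0// lerDl.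
Qed.

Lemma continuous_borel_measurable f : continuous f ->
  measurable_fun [set: borel X] (f : borel X -> R).
Proof.
move=> /continuousP cf; apply: (measurability _ (RGenOpens.measurableE R)).
move=> _ [_ [a [b ->] <-]]; rewrite setTI; apply: sub_sigma_algebra.
exact/cf/interval_open.
Qed.

Lemma lip1M f g : lip1 f -> lip1 g -> lip1 (fun x => f x * g x).
Proof.
have [D hD] := diameter.
exact: (lipM (fun x y => mdist_ge0 x y) (point : X) hD).
Qed.

Lemma lip1_bounded f : lip1 f -> exists2 M, 0 <= M & forall x, `|f x| <= M.
Proof.
have [D hD] := diameter.
exact: (lip_bounded (fun x y => mdist_ge0 x y) (point : X) hD).
Qed.

Lemma lip1_expR f : lip1 f -> lip1 (fun x => expR (f x)).
Proof.
have [D hD] := diameter.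
exact: (lip_expR (fun x y => mdist_ge0 x y) (point : X) hD).
Qed.

Lemma continuous_integrable nu (A : set (borel X)) f : measurable A ->
  continuous f -> nu.-integrable A (EFin \o f).
Proof.
move=> mA cf; apply: (@integrableS _ _ _ nu setT) => //.
apply: measurable_bounded_integrable => //.
- by rewrite (le_lt_trans (probability_le1 nu _))// ltry.
- exact: continuous_borel_measurable.
- have /compact_bounded[M [_ mrt]] :=
    continuous_compact (continuous_subspaceT cf) cX.
  by exists M; split; rewrite ?num_real // => ? ? ? ?; exact: mrt.
Qed.

Lemma lip1_integrable nu (A : set (borel X)) f : measurable A ->
  lip1 f -> nu.-integrable A (EFin \o f).
Proof. by move=> mA /lip1_continuous; exact: continuous_integrable. Qed.

(** Induction on the net cuts off the part of [A] in the ball around [y] and puts its mass for the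
    density [f] at [y]; there [h] differs from [h y] by at most [l * d]. Letting [A] vary keeps the
    cells disjoint. *)
Lemma cell_approx nu f (d : R) (s : seq X) (A : set (borel X)) :
  lip1 f -> (forall x, 0 <= f x) -> 0 < d -> measurable A ->
  (forall x, A x -> exists2 y, y \in s & mdist y x < d) ->
  exists w : seq (X * R), weight w = \int[nu]_(x in A) f x /\
    forall l h, 0 <= l -> lipw l h ->
      `|\int[nu]_(x in A) (f x * h x) - wsum w h|
        <= (\int[nu]_(x in A) f x) * (l * d).
Proof.
move=> Lf f0 d0; elim: s A => [|y s IH] A mA As.
  have -> : A = set0 by apply/seteqP; split => // x /As[].
  exists [::]; rewrite /weight big_nil Rintegral_set0; split=> // l h _ _.
  by rewrite Rintegral_set0 /wsum big_nil subrr normr0 mul0r.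
pose B : set (borel X) := ball y d.
have mB : measurable B by apply: sub_sigma_algebra; exact: open_ballm.
have mAB : measurable (A `&` B) by exact: measurableI.
have mAD : measurable (A `\` B) by exact: measurableD.
have [x [Ax nBx]|w [w1 w2]] := IH (A `\` B) mAD.
  have [z] := As x Ax; rewrite inE => /predU1P[->|zs] zx; last by exists z.
  by exfalso; apply: nBx; rewrite /B ballEmdist.
have split_int g : lip1 g -> \int[nu]_(x in A) g x =
    \int[nu]_(x in A `&` B) g x + \int[nu]_(x in A `\` B) g x.
  move=> Lg; rewrite -[in LHS](setUIDK A B) Rintegral_setU//.
    by rewrite setUIDK; exact: lip1_integrable.
  by apply/disj_setPS => x [[_ Bx] [_ /(_ Bx)]].
have i0 : 0 <= \int[nu]_(x in A `&` B) f x by exact: Rintegral_ge0.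
exists ((y, \int[nu]_(x in A `&` B) f x) :: w); split.
  by rewrite /weight big_cons/= -/(weight w) w1 ger0_norm// -split_int.
move=> l h l0 lh; have Lh : lip1 h by exists l.
have Lfh := lip1M Lf Lh.
rewrite (split_int _ Lfh) (split_int _ Lf) /wsum big_cons/= -/(wsum w h).
rewrite opprD addrACA mulrDl (le_trans (ler_normD _ _))// lerD// ?w2//.
rewrite -RintegralZr//; last exact: lip1_integrable.
rewrite -RintegralB//; [|exact: lip1_integrable|]; last first.
  apply: lip1_integrable => //; apply: lip1M => //; exact: lip_cst.
rewrite (le_trans (le_normr_Rintegral _ _))//.
  apply: lip1_integrable => //; apply: lipB => //.
  apply: lip1M => //; exact: lip_cst.
rewrite -RintegralZr//; last exact: lip1_integrable.
apply: le_Rintegral => //.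
- apply: lip1_integrable => //; apply: lip_norm; apply: lipB => //.
  apply: lip1M => //; exact: lip_cst.
- apply: lip1_integrable => //; apply: lip1M => //; exact: lip_cst.
- move=> x [_]; rewrite /B ballEmdist/= => yx.
  rewrite -mulrBr normrM ger0_norm// ler_wpM2l// (le_trans (lh _ _))//.
  by rewrite ler_wpM2l// metric_sym ltW.
Qed.

Lemma tame_integral nu f : lip1 f -> (forall x, 0 <= f x) ->
  tame (\int[nu]_x f x) (fun h => \int[nu]_x (f x * h x)).
Proof.
move=> Lf f0 d d0; have [s hs] := finite_net d0.
have [//|x _|w [w1 w2]] := @cell_approx nu f d s setT Lf f0 d0; first exact: hs.
by exists w; rewrite w1; split.
Qed.

End integration.

(** * The null space of the energy *)

Lemma ler_small_error {R : realFieldType} (a b c e0 : R) : 0 < e0 -> 0 <= c ->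
  (forall e, 0 < e -> e <= e0 -> a <= b + c * e) -> a <= b.
Proof.
move=> e00 c0 h; apply: (ler_linear_error c0) => e ep.
have m0 : 0 < Num.min e e0 by rewrite lt_min ep.
rewrite (le_trans (h _ m0 _)) ?ge_min ?lexx ?orbT//.
by rewrite lerD2l ler_wpM2l// ge_min lexx.
Qed.

Lemma sum_undup_fst {R : realType} {T : eqType} (s : seq (T * R)) (F : T -> R) :
  \sum_(p <- s) p.2 * F p.1 =
  \sum_(x <- undup [seq p.1 | p <- s]) (\sum_(p <- s | p.1 == x) p.2) * F x.
Proof.
transitivity (\sum_(x <- undup [seq p.1 | p <- s])
    \sum_(p <- s | p.1 == x) p.2 * F p.1); last first.
  apply: eq_bigr => x _; rewrite mulr_suml.
  by apply: eq_bigr => p /eqP ->.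
rewrite (exchange_big_dep xpredT)//= big_seq [RHS]big_seq.
apply: eq_bigr => p ps.
have -> : forall r, \sum_(x <- r | p.1 == x) p.2 * F p.1 =
    \sum_(x <- [seq x <- r | x == p.1]) p.2 * F p.1.
  by move=> r; rewrite big_filter; apply: eq_bigl => x; rewrite eq_sym.
by rewrite filter_pred1_uniq ?undup_uniq ?big_seq1// mem_undup map_f.
Qed.

(** The hypothesis concerns distinct points, so equal points are merged: [u] lists them and [c] adds
    up their weights. *)
Lemma psd_positive_definite {R : realType} {T : eqType} (d : T -> T -> R) :
  (forall x y, d x y = d y x) -> positive_definite d ->
  psd (fun x y => expR (- d x y)).
Proof.
move=> ds pd; split=> [x y|s]; first by rewrite ds.
pose u := undup [seq p.1 | p <- s]; pose c x := \sum_(p <- s | p.1 == x) p.2.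
have -> : kform (fun x y => expR (- d x y)) s =
    \sum_(x <- u) \sum_(y <- u) c x * c y * expR (- d x y).
  rewrite /kform; under eq_bigr => p _.
    under eq_bigr do rewrite -mulrA.
    rewrite -mulr_sumr (sum_undup_fst s (fun y => expR (- d p.1 y))); over.
  rewrite (sum_undup_fst s (fun x => \sum_(y <- u) c y * expR (- d x y))).
  apply: eq_bigr => x _.
  by rewrite mulr_sumr; apply: eq_bigr => y _; rewrite mulrA.
(* The first point serves as the default value of [nth]. *)
case: s @u @c => [|[x0 a0] s] u c; first by rewrite big_nil.
pose x (i : 'I_(size u)) := nth x0 u i.
have xinj : injective x.
  move=> i j /eqP; rewrite /x nth_uniq ?undup_uniq//; first by move/eqP/val_inj.
pose v : 'rV[R]_(size u) := \row_i c (x i).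
have [v0|/(proj2 (pd _ _ xinj))] := eqVneq v 0.
  rewrite big1_seq// => y /andP[_ yu]; rewrite big1// => z _.
  have iu : (index y u < size u)%N by rewrite index_mem.
  have := congr1 (fun A : 'rV[R]__ => A 0 (Ordinal iu)) v0.
  by rewrite !mxE /x nth_index// => ->; rewrite !mul0r.
move=> /ltW; congr (0 <= _).
rewrite mxE (big_nth x0) big_mkord.
under eq_bigr do rewrite mxE mulr_suml.
rewrite exchange_big/=; apply: eq_bigr => i _.
rewrite (big_nth x0) big_mkord; apply: eq_bigr => j _.
by rewrite !mxE mulrAC.
Qed.

Lemma kform_le {R : realType} {T : Type} (k : T -> T -> R) s M :
  (forall x y, `|k x y| <= M) -> `|kform k s| <= (\sum_(p <- s) `|p.2|) ^+ 2 * M.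
Proof.
move=> kM; rewrite /kform expr2 !mulr_suml (le_trans (ler_norm_sum _ _ _))//.
apply: ler_sum => p _; rewrite mulr_sumr mulr_suml (le_trans (ler_norm_sum _ _ _))//.
by apply: ler_sum => q _; rewrite normrM ler_pM// normrM.
Qed.

(** The tangent inequality at [- u] and at [u] traps [expR (- u)] between [1 - u] and [1 / (1 + u)];
    the next lemma mirrors this. *)
Lemma expRN_taylor {R : realType} (u : R) : 0 <= u ->
  `|expR (- u) - 1 + u| <= u ^+ 2.
Proof.
move=> u0; have h1 := expR_ge1Dx (- u); rewrite ger0_norm; last lra.
have h2 : expR (- u) * (1 + u) <= 1.
  apply: (@le_trans _ _ (expR (- u) * expR u)).
    by rewrite ler_wpM2l ?expR_ge0 ?expR_ge1Dx.
  by rewrite -expRD addNr expR0.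
have h3 : 0 <= expR (- u) by exact: expR_ge0.
by nra.
Qed.

Lemma expR_taylor {R : realType} (u : R) : 0 <= u -> u <= 1 / 2 ->
  `|expR u - 1 - u| <= 2 * u ^+ 2.
Proof.
move=> u0 u1; have h1 := expR_ge1Dx u; rewrite ger0_norm; last lra.
have h2 : expR u * (1 - u) <= 1.
  apply: (@le_trans _ _ (expR u * expR (- u))).
    by rewrite ler_wpM2l ?expR_ge0 ?expR_ge1Dx.
  by rewrite -expRD subrr expR0.
by nra.
Qed.

Section null_space.
Context {R : realType} {X : pmetricType R}.
Hypothesis cX : compact [set: X].
Hypothesis nX : negative_type X.
Implicit Types (L : (X -> R) -> R) (f g : X -> R) (k : X -> X -> R).

Notation lip1 := (lip (@mdist R X)).
Notation lip2 k := (lip dist2 (fun p : X * X => k p.1 p.2)).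

Lemma dist2_ge0 (p q : X * X) : 0 <= dist2 p q.
Proof. by rewrite addr_ge0 ?mdist_ge0. Qed.

Lemma dist2_diameter : exists D : R, forall p q : X * X, dist2 p q <= D.
Proof. by have [D hD] := diameter cX; exists (D + D) => p q; rewrite lerD. Qed.

Lemma lip2M k k' : lip2 k -> lip2 k' -> lip2 (fun x y => k x y * k' x y).
Proof.
have [D hD] := dist2_diameter.
exact: (lipM dist2_ge0 (point : X, point : X) hD).
Qed.

Lemma lip2_expR k : lip2 k -> lip2 (fun x y => expR (k x y)).
Proof.
have [D hD] := dist2_diameter.
exact: (lip_expR dist2_ge0 (point : X, point : X) hD).
Qed.

Lemma lip2_fst f : lip1 f -> lip2 (fun x _ => f x).
Proof.
move=> [l l0 lf]; exists l => // p q; rewrite (le_trans (lf _ _))// ler_wpM2l//.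
by rewrite lerDl mdist_ge0.
Qed.

Lemma lip2_snd f : lip1 f -> lip2 (fun _ y => f y).
Proof. by move/lip2_fst/lip2_swap. Qed.

Lemma lip2_tensor f g : lip1 f -> lip1 g -> lip2 (fun x y => f x * g y).
Proof. by move=> lf lg; exact: (lip2M (lip2_fst lf) (lip2_snd lg)). Qed.

Lemma lip2_dist : lip2 (fun x y => mdist x y).
Proof.
exists 1 => // p q; rewrite mul1r /dist2 ler_norml.
have := metric_triangle p.1 q.1 p.2; have := metric_triangle q.1 q.2 p.2.
have := metric_triangle q.1 p.1 q.2; have := metric_triangle p.1 p.2 q.2.
by rewrite (metric_sym q.1 p.1) (metric_sym q.2 p.2); lra.
Qed.

Definition expdist (t : R) (x y : X) : R := expR (- (t * mdist x y)).

Lemma expdist_sym t x y : expdist t x y = expdist t y x.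
Proof. by rewrite /expdist metric_sym. Qed.

Lemma expdistxx t x : expdist t x x = 1.
Proof. by rewrite /expdist mdistxx mulr0 oppr0 expR0. Qed.

Lemma lip2_expdist t : lip2 (expdist t).
Proof.
apply: (@lip2_expR (fun x y => - (t * mdist x y))).
by apply/lipN/lipZ/lip2_dist.
Qed.

Lemma lip1_expdist t x : lip1 (expdist t x).
Proof. exact: (lip2_r x (lip2_expdist t)). Qed.

Lemma psd_expdist t : 0 < t -> psd (expdist t).
Proof.
move=> t0; apply: (@psd_positive_definite _ _ (@scaled_dist R X t)); last exact: nX.
by move=> x y; rewrite /scaled_dist metric_sym.
Qed.

(** Twice the Gromov product of [x] and [y] at the base point [z]. *)
Definition gromov (z x y : X) : R := mdist x z + mdist y z - mdist x y.

Lemma gromovxx z y : gromov z y y = 2 * mdist y z.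
Proof. by rewrite /gromov mdistxx subr0 mulr2n mulrDl mul1r. Qed.

Lemma lip2_gromov z : lip2 (gromov z).
Proof.
have lz : lip1 (fun x => mdist x z).
  by apply: eq_lip (lip1_dist z) => x; rewrite metric_sym.
exact: (lipB (lipD (lip2_fst lz) (lip2_snd lz)) lip2_dist).
Qed.

(* Schoenberg: the first-order term of [expR (- e d)] at [e = 0], tested on
   weights of zero sum. *)
Lemma psd_gromov z : psd (gromov z).
Proof.
split=> [x y|s]; first by rewrite /gromov (metric_sym x y) [X in X - _]addrC.
(* The base point absorbs the total weight, so that [s'] has zero sum. *)
pose S := \sum_(p <- s) p.2; pose s' := (z, - S) :: s.
have Es : kform (gromov z) s = - kform (fun x y => mdist x y) s'.
  rewrite [in RHS]kform_cons/=; last exact: metric_sym.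
  rewrite mdistxx mulr0 add0r.
  have -> : kform (gromov z) s = kform (fun x _ => mdist x z) s
      + kform (fun _ y => mdist y z) s + - 1 * kform (fun x y => mdist x y) s.
    by rewrite -kformZ -!kformD; apply: eq_kform => x y; rewrite /gromov mulN1r.
  have -> : kform (fun x _ => mdist x z) s = S * \sum_(q <- s) q.2 * mdist q.1 z.
    rewrite /kform mulrC mulr_suml; apply: eq_bigr => p _.
    by rewrite mulr_sumr; apply: eq_bigr => q _; rewrite mulrAC.
  have -> : kform (fun _ y => mdist y z) s = S * \sum_(q <- s) q.2 * mdist q.1 z.
    rewrite /kform mulr_suml; apply: eq_bigr => p _.
    by rewrite mulr_sumr; apply: eq_bigr => q _; rewrite mulrA.
  by ring.
have Es1 : kform (fun _ _ => 1) s' = 0.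
  rewrite (_ : kform _ _ = (\sum_(p <- s') p.2) ^+ 2).
    by rewrite big_cons/= addNr expr0n.
  by rewrite /kform expr2 mulr_suml; apply: eq_bigr => p _; rewrite mulr_sumr;
    apply: eq_bigr => q _; rewrite mulr1.
have [D hD] := diameter cX.
rewrite Es; apply: (@ler_linear_error _ _ _
  ((\sum_(p <- s') `|p.2|) ^+ 2 * D ^+ 2)).
  by rewrite mulr_ge0 ?sqr_ge0.
move=> e e0; have [_ /(_ s')] := psd_expdist e0.
have bnd (x y : X) : `|expR (- (e * mdist x y)) - 1 + e * mdist x y| <= (e * D) ^+ 2.
  have exy : 0 <= e * mdist x y by rewrite mulr_ge0 ?mdist_ge0 ?ltW.
  rewrite (le_trans (expRN_taylor exy))// lerXn2r ?nnegrE//.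
    by rewrite mulr_ge0 ?(ltW e0)// (le_trans _ (hD x x))// mdist_ge0.
  by rewrite ler_wpM2l// ltW.
have := kform_le s' bnd.
have -> : kform (fun x y => expR (- (e * mdist x y)) - 1 + e * mdist x y) s' =
  kform (expdist e) s' + - 1 * kform (fun _ _ => 1) s'
  + e * kform (fun x y => mdist x y) s'.
  by rewrite -!kformZ -!kformD; apply: eq_kform => x y; rewrite mulN1r.
rewrite Es1 mulr0 addr0.
rewrite ler_norml => /andP[_ h1] h2; rewrite -(ler_pM2l e0) mulr0.
move: h1 h2; set A := kform _ _; set B := kform _ _; set W := _ ^+ 2 => h1 h2.
have -> : e * (- B + W * D ^+ 2 * e) = W * (e * D) ^+ 2 - e * B by ring.
by lra.
Qed.

End null_space.

(** * Energy and null densities *)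

Section energy.
Context {R : realType} {X : pmetricType R}.
Hypothesis cX : compact [set: X].
Hypothesis nX : negative_type X.
Context (C : R) (L : (X -> R) -> R).
Hypothesis tL : tame C L.
Implicit Types (f g : X -> R) (k : X -> X -> R).

Notation lip1 := (lip (@mdist R X)).
Notation lip2 k := (lip dist2 (fun p : X * X => k p.1 p.2)).

Definition energy k : R := L (fun x => L (k x)).

Lemma eq_energy k k' : (forall x y, k x y = k' x y) -> energy k = energy k'.
Proof. by move=> kk'; congr L; apply/funext => x; congr L; apply/funext => y. Qed.

Lemma energy_lin a k k' : lip2 k -> lip2 k' ->
  energy (fun x y => a * k x y + k' x y) = a * energy k + energy k'.
Proof.
move=> lk lk'; rewrite /energy.
rewrite -(tame_lin _ tL); [|exact: (lip_tame_kernel tL)..].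
congr L; apply/funext => x; rewrite -(tame_lin _ tL)//; exact: lip2_r.
Qed.

Lemma energyZ a k : lip2 k -> energy (fun x y => a * k x y) = a * energy k.
Proof.
move=> lk; rewrite /energy -(tame_Z _ tL); last exact: (lip_tame_kernel tL).
by congr L; apply/funext => x; rewrite -(tame_Z _ tL)//; exact: lip2_r.
Qed.

Lemma energyD k k' : lip2 k -> lip2 k' ->
  energy (fun x y => k x y + k' x y) = energy k + energy k'.
Proof.
move=> lk lk'; rewrite -[X in X + _]mul1r -energy_lin//.
by apply: eq_energy => x y; rewrite mul1r.
Qed.

Lemma energy_le k M : lip2 k -> (forall x y, `|k x y| <= M) ->
  `|energy k| <= C * (C * M).
Proof.
move=> lk kM; apply: (tame_le tL); first exact: (lip_tame_kernel tL).
by move=> x; apply: (tame_le tL) => //; exact: lip2_r.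
Qed.

Lemma energy_tensor f g : lip1 f -> lip1 g ->
  energy (fun x y => f x * g y) = L f * L g.
Proof.
move=> lf lg; rewrite /energy.
transitivity (L (fun x => L g * f x)); last by rewrite (tame_Z _ tL)// mulrC.
by congr L; apply/funext => x; rewrite (tame_Z _ tL)// mulrC.
Qed.

Variable t : R.
Hypothesis t0 : 0 < t.
Notation K := (@expdist R X t).

Let lK w : lip1 (K w) := lip1_expdist cX t w.

Let lKK : lip2 K := lip2_expdist cX t.

(** The potential, rather than the energy, is required to vanish: this is linear in [f], and
    [energy_null] recovers it from a nonpositive energy. *)
Definition null f := lip1 f /\ forall w, L (fun x => f x * K w x) = 0.

Definition weighted f k (x y : X) := f x * f y * k x y.

Lemma lip2_weighted f k : lip1 f -> lip2 k -> lip2 (weighted f k).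
Proof. by move=> lf lk; exact: (lip2M cX (lip2_tensor cX lf lf) lk). Qed.

Lemma null_energyM f g : null f -> lip1 g ->
  energy (fun x y => g x * (f y * K x y)) = 0.
Proof.
move=> [lf Nf] lg; rewrite -[RHS](tame0 tL); congr L; apply/funext => x.
rewrite -[RHS](mulr0 (g x)) -(Nf x) -(tame_Z _ tL)//; exact: (lip1M cX).
Qed.

(** Cauchy-Schwarz against the point mass at [w]: by the Schur complement at [w], where [K w w = 1],
    the square of the potential at [w] is at most the energy. *)
Lemma energy_null f : lip1 f -> energy (weighted f K) <= 0 -> null f.
Proof.
move=> lf E0; split=> // w.
have lKw : lip1 (fun x => f x * K w x) by exact: (lip1M cX).
have l1 := lip2_tensor cX lKw lKw.
have l2 := lip2_weighted lf lKK.
have : 0 <= energy (fun x y =>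
    (-1) * ((f x * K w x) * (f y * K w y)) + weighted f K x y).
  apply: (tame_psd tL); first exact: (lipD (lipZ (-1) l1) l2).
  apply: eq_psd (psd_weight f (psd_complement w (psd_expdist nX t0))) => x y.
  by rewrite expdistxx (expdist_sym t x w) (expdist_sym t y w) /weighted; ring.
rewrite energy_lin// energy_tensor// mulN1r -expr2 => P.
by apply/eqP; rewrite -sqrf_eq0 eq_le sqr_ge0 andbT; lra.
Qed.

(** At scale [t - e] the energy weighted by [f] is nonnegative, and it vanishes at [e = 0]; so its
    derivative there, which is the energy of [mdist * K], is nonnegative. *)
Lemma energy_deriv f : null f ->
  0 <= energy (weighted f (fun x y => mdist x y * K x y)).
Proof.
move=> [lf Nf]; have [D hD] := diameter cX; have [F F0 hF] := lip1_bounded cX lf.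
have C0 := tame_ge0 tL.
have D0 : 0 <= D by rewrite (le_trans _ (hD point point))// mdist_ge0.
have D1 : 0 < 2 * (D + 1) by rewrite mulr_gt0// ltr_wpDl.
pose c := C * (C * (F * F * (2 * D ^+ 2))).
(* The bound [t / 2] keeps the scale [t - e] positive, and the other one makes [e * mdist x y] at
   most 1/2, as [expR_taylor] demands. The constant [c] bounds the energy of the remainder divided
   by [e ^+ 2]. *)
apply: (@ler_small_error _ _ _ c (Num.min (t / 2) (2 * (D + 1))^-1)).
- by rewrite lt_min divr_gt0//= invr_gt0.
- by rewrite /c !mulr_ge0 ?sqr_ge0.
move=> e e0; rewrite le_min => /andP[et eD].
have te : 0 < t - e by move: et t0; lra.
pose r x y := (expR (e * mdist x y) - 1 - e * mdist x y) * K x y.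
have led : lip2 (fun x y => e * mdist x y) by apply/lipZ/lip2_dist.
have lr : lip2 r.
  have l0 := @lip2_expR _ _ cX (fun x y => e * mdist x y) led.
  have l1 := lipB (lipB l0 (lip_cst dist2 1)) led.
  exact: (@lip2M _ _ cX (fun x y => expR (e * mdist x y) - 1 - e * mdist x y)
    _ l1 lKK).
pose dK (x y : X) := mdist x y * K x y.
have ld : lip2 dK := lip2M cX lip2_dist lKK.
have wd := lip2_weighted lf ld; have wK := lip2_weighted lf lKK.
have wr := lip2_weighted lf lr.
have : 0 <= energy (fun x y => e * weighted f dK x y
        + (weighted f K x y + weighted f r x y)).
  apply: (tame_psd tL); first exact: (lipD (lipZ e wd) (lipD wK wr)).
  apply: eq_psd (psd_weight f (psd_expdist nX te)) => x y; rewrite /weighted /r /dK.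
  have -> : expdist (t - e) x y = expR (e * mdist x y) * K x y.
    by rewrite /expdist -expRD; congr expR; ring.
  by ring.
rewrite energy_lin//; last exact: (lipD wK wr).
rewrite energyD//; rewrite -/dK; set A := energy (weighted f dK).
have -> : energy (weighted f K) = 0.
  rewrite -[RHS](null_energyM (conj lf Nf) lf).
  by apply: eq_energy => x y; rewrite /weighted mulrA.
have hr (x y : X) : `|weighted f r x y| <= F * F * (2 * (e * D) ^+ 2).
  have exy : 0 <= e * mdist x y by rewrite mulr_ge0 ?mdist_ge0 ?(ltW e0).
  have exyD : e * mdist x y <= e * D by rewrite ler_wpM2l ?(ltW e0).
  rewrite /weighted /r !normrM; apply: ler_pM; rewrite ?mulr_ge0//.
    by rewrite ler_pM.
  rewrite -[X in _ <= X]mulr1 ler_pM//; last first.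
    rewrite /expdist ger0_norm ?expR_ge0// -expR0 ler_expR oppr_le0.
    by rewrite mulr_ge0 ?mdist_ge0 ?(ltW t0).
  rewrite (le_trans (expR_taylor exy _))//.
    rewrite (le_trans exyD)//.
    have := eD; rewrite -(ler_pM2r D1) mulVf ?gt_eqF//.
    by nra.
  by rewrite ler_pM2l// lerXn2r ?nnegrE// mulr_ge0// ltW.
have := energy_le wr hr; rewrite ler_norml => /andP[_ h1] h2.
rewrite -(ler_pM2l e0) mulr0 mulrDr.
have -> : e * (c * e) = C * (C * (F * F * (2 * (e * D) ^+ 2))).
  by rewrite /c; ring.
by lra.
Qed.

(* The kernel [2 d(y,z) * gromov z - h * h] is positive by Schur complement and
   stays so after multiplication by [K]; the energy of [gromov z * K] weighted
   by a null [f] is nonpositive, whence so is that of [K] weighted by [f * h]. *)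
Lemma null_step f z y : null f -> null (fun x => f x * (mdist x z - mdist x y)).
Proof.
move=> nf; have [lf Nf] := nf.
have lz v : lip1 (fun x => mdist x v).
  by apply: eq_lip (lip1_dist v) => x; rewrite metric_sym.
pose h x := gromov z x y.
have lh : lip1 h := lip2_l y (lip2_gromov z).
have lfh : lip1 (fun x => f x * h x) := lip1M cX lf lh.
(* [h] differs from the wanted factor by the constant [mdist y z]. *)
suff [_ Nfh] : null (fun x => f x * h x).
  split; first exact: (lip1M cX lf (lipB (lz z) (lz y))).
  move=> w; have lfK : lip1 (fun x => f x * K w x) := lip1M cX lf (lK w).
  have lfhK : lip1 (fun x => f x * h x * K w x) := lip1M cX lfh (lK w).
  have -> : (fun x => f x * (mdist x z - mdist x y) * K w x) =
      (fun x => (- mdist y z) * (f x * K w x) + f x * h x * K w x).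
    by apply/funext => x; rewrite /h /gromov; ring.
  by rewrite (tame_lin _ tL)// Nf Nfh mulr0 addr0.
apply: (energy_null lfh).
pose dK (x x' : X) := mdist x x' * K x x'.
have ldK : lip2 dK := lip2M cX lip2_dist lKK.
have lfz : lip1 (fun x => f x * mdist x z) := lip1M cX lf (lz z).
have lfK : lip2 (fun x x' => f x' * K x x') := lip2M cX (lip2_snd lf) lKK.
have lfzK : lip2 (fun x x' => f x' * mdist x' z * K x x').
  exact: (lip2M cX (lip2_snd lfz) lKK).
have lA := @lip2M _ _ cX _ (fun x x' => f x' * K x x') (lip2_fst lfz) lfK.
have lB := @lip2M _ _ cX _ (fun x x' => f x' * mdist x' z * K x x')
  (lip2_fst lf) lfzK.
have lD := lip2_weighted lf ldK.
have lH := lip2_weighted lfh lKK.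
have lAB := lipD lA lB.
(* The positive kernel is expanded: the two terms in the distance to [z] have zero energy because
   [f] is null, and the term in [dK] is nonpositive by [energy_deriv]. *)
have : 0 <= energy (fun x x' => (- 1) * weighted (fun x => f x * h x) K x x' +
    (2 * mdist y z) * ((- 1) * weighted f dK x x' +
      (f x * mdist x z * (f x' * K x x') + f x * (f x' * mdist x' z * K x x')))).
  apply: (tame_psd tL).
    exact: (lipD (lipZ (-1) lH) (lipZ _ (lipD (lipZ (-1) lD) lAB))).
  apply: eq_psd (psd_weight f (psdM (psd_complement y (psd_gromov cX nX z))
    (psd_expdist nX t0))) => x x'.
  by rewrite /weighted /h gromovxx /dK /gromov; ring.
rewrite energy_lin//; last exact: (lipZ _ (lipD (lipZ (-1) lD) lAB)).
rewrite energyZ; last exact: (lipD (lipZ (-1) lD) lAB).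
rewrite energy_lin// energyD// (null_energyM nf lfz).
have -> : energy (fun x x' => f x * (f x' * mdist x' z * K x x')) = 0.
  rewrite /energy (tame_Fubini tL tL lB) -[RHS](null_energyM nf lfz).
  apply: eq_energy => x x'; rewrite expdist_sym; ring.
rewrite !addr0 mulN1r mulN1r => E; have := energy_deriv nf; rewrite -/dK => Dge.
have := mdist_ge0 y z.
by move: E Dge; set A := energy _; set B := energy _; set d := mdist _ _; nra.
Qed.

End energy.

(** * Polynomial approximation of the absolute value *)

Section abs_approximation.
Context {R : realFieldType}.

(** The iteration used in the Stone-Weierstrass theorem: polynomials in [u] increasing to the
    absolute value of [u] on [-1, 1]. *)
Fixpoint abs_approx n (u : R) : R :=
  if n is m.+1 then abs_approx m u + (u ^+ 2 - abs_approx m u ^+ 2) / 2 else 0.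

(** One step turns the error [x] into at most [x * (1 - x / 2)], which is increasing in [x] on
    [0, 1]; so a bound [2 / m] becomes [2 / (m + 1)]. *)
Lemma abs_approxP n (u : R) : `|u| <= 1 ->
  [/\ 0 <= abs_approx n u, abs_approx n u <= `|u| &
      (`|u| - abs_approx n u) * n.+2%:R <= 2].
Proof.
move=> u1; rewrite /=; elim: n => [|n [IH0 IH1 IH2]] /=.
  by rewrite subr0; split => //; move: u1; set a := `|u|; lra.
rewrite -[u ^+ 2]real_normK ?num_real//.
have a0 : 0 <= `|u| by [].
move: IH0 IH1 IH2; set p := abs_approx n u; set a := `|u| in a0 u1 * => p0 pa.
have n2 : 2 <= n.+2%:R :> R by rewrite ler_nat.
rewrite -[n.+3%:R]natr1; move: n2; set m := n.+2%:R => m2 h.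
have q : a - (p + (a ^+ 2 - p ^+ 2) / 2) = (a - p) * (1 - (a + p) / 2) by field.
split; [by nra|by rewrite -subr_ge0 q mulr_ge0//; lra|rewrite q].
have {h}h : a - p <= 2 / m by rewrite ler_pdivlMr//; lra.
have d0 : 0 <= a - p by lra.
have d1 : 2 / m <= 1 by rewrite ler_pdivrMr ?mul1r//; lra.
apply: (@le_trans _ _ ((2 / m) * (1 - (2 / m) / 2) * (m + 1))).
  rewrite ler_pM2r//; last lra.
  apply: (@le_trans _ _ ((a - p) * (1 - (a - p) / 2))).
    by rewrite ler_wpM2l//; lra.
  by move: h d0 d1; set x := a - p; set y := 2 / m => *; nra.
have -> : 2 / m * (1 - 2 / m / 2) * (m + 1) = 2 - 2 / (m ^+ 2).
  by field; rewrite gt_eqF//; lra.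
by rewrite gerBl divr_ge0// sqr_ge0.
Qed.

End abs_approximation.

(** * Multipliers of the null densities *)

Section multipliers.
Context {R : realType} {X : pmetricType R}.
Hypothesis cX : compact [set: X].
Hypothesis nX : negative_type X.
Context (C : R) (L : (X -> R) -> R).
Hypothesis tL : tame C L.
Context (t : R).
Hypothesis t0 : 0 < t.
Implicit Types (f g h : X -> R).

Notation lip1 := (lip (@mdist R X)).
Notation K := (@expdist R X t).
Notation null := (null L t).

(** Null densities form only a linear space; their multipliers form an algebra, which the lattice
    argument requires. *)
Definition multiplier h := lip1 h /\ forall f, null f -> null (fun x => f x * h x).

Lemma eq_multiplier g h : (forall x, g x = h x) -> multiplier g -> multiplier h.
Proof. by move=> /funext ->. Qed.

Let lK w : lip1 (K w) := lip1_expdist cX t w.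

Lemma multiplier_lin a g h : multiplier g -> multiplier h ->
  multiplier (fun x => a * g x + h x).
Proof.
move=> [lg mg] [lh mh]; split=> [|f nf]; first exact: (lipD (lipZ a lg) lh).
have [lf _] := nf; split; first exact: (lip1M cX lf (lipD (lipZ a lg) lh)).
have [lfg Ng] := mg _ nf; have [lfh Nh] := mh _ nf; move=> w.
have -> : (fun x => f x * (a * g x + h x) * K w x) =
    (fun x => a * (f x * g x * K w x) + f x * h x * K w x).
  by apply/funext => x; ring.
by rewrite (tame_lin _ tL) ?Ng ?Nh ?mulr0 ?addr0//; exact: (lip1M cX).
Qed.

Lemma multiplierM g h : multiplier g -> multiplier h ->
  multiplier (fun x => g x * h x).
Proof.
move=> [lg mg] [lh mh]; split=> [|f nf]; first exact: (lip1M cX).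
have := mh _ (mg _ nf); congr null; apply/funext => x; exact/esym/mulrA.
Qed.

Lemma multiplier0 : multiplier (fun=> 0).
Proof.
have l0 : lip1 (fun=> 0) := lip_cst _ 0.
split=> // f [lf _]; split; first exact: (lip1M cX).
move=> w; rewrite -[RHS](tame0 tL); congr L; apply/funext => x.
by rewrite mulr0 mul0r.
Qed.

Lemma multiplier_cst (a : R) : multiplier (fun=> a).
Proof.
have m1 : multiplier (fun=> 1).
  split=> [|f]; first exact: lip_cst.
  by congr null; apply/funext => x; rewrite mulr1.
by apply: eq_multiplier (multiplier_lin a m1 multiplier0) => x; rewrite mulr1 addr0.
Qed.

Lemma multiplierZ a h : multiplier h -> multiplier (fun x => a * h x).
Proof.
by move=> mh; apply: eq_multiplier (multiplier_lin a mh multiplier0) => x; rewrite addr0.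
Qed.

Lemma multiplierD g h : multiplier g -> multiplier h ->
  multiplier (fun x => g x + h x).
Proof.
by move=> mg mh; apply: eq_multiplier (multiplier_lin 1 mg mh) => x; rewrite mul1r.
Qed.

Lemma multiplier_dist z y : multiplier (fun x => mdist x z - mdist x y).
Proof.
have lz v : lip1 (fun x => mdist x v).
  by apply: eq_lip (lip1_dist v) => x; rewrite metric_sym.
by split=> [|f nf]; [exact: lipB|exact: (null_step cX nX tL)].
Qed.

Lemma multiplier_lim h : lip1 h ->
  (forall e, 0 < e -> exists2 g, multiplier g & forall x, `|h x - g x| <= e) ->
  multiplier h.
Proof.
move=> lh hg; split=> // f nf; have [lf Nf] := nf; split; first exact: (lip1M cX).
have [F F0 hF] := lip1_bounded cX lf; have C0 := tame_ge0 tL.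
move=> w; apply: (@eq_linear_error _ _ (C * F)); first exact: mulr_ge0.
move=> e e0; have [g mg gh] := hg e e0; have [lg _] := mg.
have [lfg Nfg] := proj2 mg _ nf.
have lfh := lip1M cX lf lh.
rewrite -[X in `|X|]subr0 -(Nfg w) -(tame_B tL); [|exact: (lip1M cX)..].
rewrite -mulrA; apply: (tame_le tL).
  by apply: lipB; exact: (lip1M cX).
move=> x; rewrite -mulrBl -mulrBr !normrM -[e]mulr1 -!mulrA ler_pM//.
rewrite ler_pM// /expdist ger0_norm ?expR_ge0// -expR0 ler_expR oppr_le0.
by rewrite mulr_ge0 ?mdist_ge0// ltW.
Qed.

Lemma multiplier_abs_approx n h : multiplier h ->
  multiplier (fun x => abs_approx n (h x)).
Proof.
move=> mh; elim: n => [|n IH] /=; first exact: multiplier_cst.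
have := multiplierD IH (multiplierZ 2^-1 (multiplier_lin (-1) (multiplierM IH IH)
  (multiplierM mh mh))).
by apply: eq_multiplier => x; rewrite !expr2; field.
Qed.

Lemma multiplier_norm h : multiplier h -> multiplier (fun x => `|h x|).
Proof.
move=> mh; have [lh _] := mh; have [B B0 hB] := lip1_bounded cX lh.
have B1 : 0 < B + 1 by rewrite ltr_wpDl.
pose g x := (B + 1)^-1 * h x.
have mg : multiplier g by exact: multiplierZ.
have g1 x : `|g x| <= 1.
  rewrite /g normrM normfV (gtr0_norm B1) ler_pdivrMl// mulr1.
  by rewrite (le_trans (hB x))// lerDl.
suff : multiplier (fun x => `|g x|).
  move/(multiplierZ (B + 1)); apply: eq_multiplier => x.
  by rewrite /g normrM normfV (gtr0_norm B1) mulVKf// gt_eqF.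
apply: multiplier_lim; first by apply: lip_norm; case: mg.
move=> e e0; have [n hn] : exists n : nat, 2 / e <= n.+2%:R.
  exists (Num.trunc (2 / e)); apply/ltW/(lt_trans (truncnS_gt _)).
  by rewrite ltr_nat.
exists (fun x => abs_approx n (g x)); first exact: multiplier_abs_approx.
move=> x; have [p0 p1 p2] := abs_approxP n (g1 x).
rewrite ger0_norm ?subr_ge0// -(@ler_pM2r _ n.+2%:R)// (le_trans p2)//.
by rewrite mulrC -ler_pdivrMr.
Qed.

Lemma multiplier_min g h : multiplier g -> multiplier h ->
  multiplier (fun x => Num.min (g x) (h x)).
Proof.
move=> mg mh.
have := multiplierZ 2^-1 (multiplier_lin (-1) (multiplier_norm
  (multiplier_lin (-1) mg mh)) (multiplierD mg mh)).
apply: eq_multiplier => x; have [gh|gh] := lerP (g x) (h x).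
  by rewrite ger0_norm; [field|lra].
by rewrite ler0_norm; [field|lra].
Qed.

(* A 1-Lipschitz [f] is the infimum of the functions [f y + mdist ^~ y]. *)
Lemma multiplier_lip_dist f z : (forall x y, `|f x - f y| <= mdist x y) ->
  multiplier (fun x => f x - mdist x z).
Proof.
move=> f1; have lz v : lip1 (fun x => mdist x v).
  by apply: eq_lip (lip1_dist v) => x; rewrite metric_sym.
have lf : lip1 f by exists 1 => // x y; rewrite mul1r.
apply: multiplier_lim => [|e e0]; first exact: lipB.
have e20 : 0 < e / 2 by rewrite divr_gt0.
have [s hs] := finite_net cX e20.
(* Only differences of distances are known to be multipliers so far; the subtracted [mdist x z] is
   common to all [F y]. *)
pose F y x := f y + (mdist x y - mdist x z).
have mF y : multiplier (F y).
  exact: (multiplierD (multiplier_cst (f y)) (multiplier_dist y z)).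
pose G r x := foldr (fun y m => Num.min (F y x) m) (F point x) r.
have mG r : multiplier (G r).
  by elim: r => [|y r IH]; [exact: mF|exact: (multiplier_min (mF y) IH)].
exists (G s) => // x.
have Flb y : f x - mdist x z <= F y x.
  have := f1 x y; rewrite ler_norml => /andP[_]; rewrite /F; lra.
have Glb r : f x - mdist x z <= G r x.
  by elim: r => [|y r IH] //=; rewrite le_min Flb.
have Gub r y : y \in r -> G r x <= F y x.
  elim: r => // a r IH; rewrite inE /= => /predU1P[->|/IH yr].
    by rewrite ge_min lexx.
  by rewrite ge_min yr orbT.
rewrite distrC ger0_norm ?subr_ge0//.
have [y ys yx] := hs x.
have := Gub s y ys; have := f1 y x; rewrite ler_norml => /andP[_].
by move: yx; rewrite /F (metric_sym x y); lra.
Qed.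

Lemma multiplier_lip f : lip1 f -> multiplier f.
Proof.
move=> [l l0 lf]; have l1 : 0 < l + 1 by rewrite ltr_wpDl.
have f1 x y : `|(l + 1)^-1 * f x - (l + 1)^-1 * f y| <= mdist x y.
  rewrite -mulrBr normrM normfV (gtr0_norm l1) ler_pdivrMl// (le_trans (lf _ _))//.
  by rewrite ler_wpM2r ?mdist_ge0// lerDl.
have m1 := multiplier_lip_dist point f1.
(* The zero function shows that the distance to [point] is itself a multiplier, so it can be added
   back. *)
have m2 : multiplier (fun x => 0 - mdist x point).
  by apply: multiplier_lip_dist => x y; rewrite subrr normr0 mdist_ge0.
have := multiplierZ (l + 1) (multiplier_lin (-1) m2 m1).
by apply: eq_multiplier => x; field; rewrite gt_eqF.
Qed.

(** The multiplier [g] carries the inverse of [K w], so that the potential of its density at [w] is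
    exactly [L f]. *)
Lemma null1_eq0 f : null (fun=> 1) -> lip1 f -> L f = 0.
Proof.
move=> n1 lf; have w : X := point.
pose g x := f x * expR (t * mdist w x).
have lg : lip1 g := lip1M cX lf (lip1_expR cX (lipZ t (lip1_dist w))).
have [_ /(_ w)] := proj2 (multiplier_lip lg) _ n1.
move=> <-; congr L; apply/funext => x.
by rewrite mul1r /g /expdist expRN mulfK// gt_eqF// expR_gt0.
Qed.

End multipliers.

(** * Lipschitz functions determine a measure *)

Section set_distance.
Context {R : realType} {X : pmetricType R}.
Variable C : set X.
Hypothesis C0 : C !=set0.

Definition set_distance (x : X) : R := inf [set mdist x y | y in C].

Let has_inf_dist x : has_inf [set mdist x y | y in C].
Proof.
split; first by have [y Cy] := C0; exists (mdist x y); exists y.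
by exists 0 => _ [y _ <-]; exact: mdist_ge0.
Qed.

Lemma set_distance_le x y : C y -> set_distance x <= mdist x y.
Proof. by move=> Cy; apply: ge_inf; [exact: (has_inf_dist x).2|exists y]. Qed.

Lemma set_distance_ge0 x : 0 <= set_distance x.
Proof.
apply: lb_le_inf; first exact: (has_inf_dist x).1.
by move=> _ [y _ <-]; exact: mdist_ge0.
Qed.

Lemma lip_set_distance : lip (@mdist R X) set_distance.
Proof.
have H x y : set_distance x <= mdist x y + set_distance y.
  rewrite -lerBlDl; apply: lb_le_inf; first exact: (has_inf_dist y).1.
  move=> _ [z Cz <-]; rewrite lerBlDl (le_trans (set_distance_le x Cz))//.
  exact: metric_triangle.
exists 1 => // x y; rewrite mul1r ler_norml.
by have := H x y; have := H y x; rewrite (metric_sym y x); lra.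
Qed.

Lemma set_distance_gt0 x : closed C -> ~ C x -> 0 < set_distance x.
Proof.
move=> cC nCx; have : nbhs x (~` C).
  by apply: open_nbhs_nbhs; split => //; exact: closed_openC.
move=> /nbhs_ballP[e /= e0 he]; apply: (lt_le_trans e0).
apply: lb_le_inf; first exact: (has_inf_dist x).1.
move=> _ [y Cy <-]; rewrite leNgt; apply/negP => xy.
by apply: (he y) => //; rewrite ballEmdist.
Qed.

End set_distance.

Section lipschitz_determine_measure.
Context {R : realType} {X : pmetricType R}.
Hypothesis cX : compact [set: X].
Implicit Types (nu mu : prob R X).

Notation lip1 := (lip (@mdist R X)).

Lemma open_borel (A : set X) : open A -> measurable (A : set (borel X)).
Proof. by move=> oA; exact: sub_sigma_algebra. Qed.

Lemma closed_borel (A : set X) : closed A -> measurable (A : set (borel X)).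
Proof.
move=> /closed_openC/open_borel/measurableC; by rewrite setCK.
Qed.

(** A Lipschitz tent lies between the indicators of [C] and of its neighbourhood [F n], and the sets
    [F n] decrease to [C]. *)
Lemma le_closed_lip nu mu (C : set (borel X)) : closed (C : set X) ->
  (forall f, lip1 f -> \int[nu]_x f x = \int[mu]_x f x) ->
  (nu C <= mu C)%E.
Proof.
move=> cC nm; have [->|/set0P C0] := eqVneq C set0; first by rewrite !measure0.
pose d := set_distance (C : set X); have d0 := set_distance_ge0 C0.
have ld : lip1 d := lip_set_distance C0.
pose F n : set (borel X) := [set x | d x < n.+1%:R^-1].
have mF n : measurable (F n).
  apply: open_borel; rewrite (_ : F n = d @^-1` [set r | r < n.+1%:R^-1])//.
  by apply: open_comp => [x _|]; [exact: lip1_continuous|exact: open_lt].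
have capF : \bigcap_n F n = C.
  apply/seteqP; split => x; last first.
    move=> Cx n _; rewrite /F/= (le_lt_trans (set_distance_le C0 x Cx))//.
    by rewrite mdistxx invr_gt0.
  move=> Fx; apply: contrapT => nCx.
  have dx := set_distance_gt0 C0 cC nCx.
  have := Fx (Num.trunc (d x)^-1) I; rewrite /F/= ltNge => /negP; apply.
  rewrite -[leRHS]invrK lef_pV2 ?posrE ?invr_gt0//.
  by rewrite ltW// truncnS_gt.
have cvF : mu (F n) @[n --> \oo] --> mu C.
  rewrite -[X in mu X]capF; apply: nonincreasing_cvg_mu => //.
  - by rewrite (le_lt_trans (probability_le1 mu _))// ltry.
  - by rewrite capF; exact: closed_borel.
  - move=> m n mn; apply/subsetPset => x; rewrite /F/= => /lt_le_trans; apply.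
    by rewrite lef_pV2 ?posrE// ler_nat.
apply: (cvge_ge _ cvF).
near=> n => /=.
(* [f] is the positive part of [g]. *)
pose g x : R := 1 - n.+1%:R * d x; pose f x := 2^-1 * (g x + `|g x|).
have lg : lip1 g by apply: lipB; [exact: lip_cst|exact: lipZ].
have lf : lip1 f by apply/lipZ/lipD => //; exact: lip_norm.
have f0 x : 0 <= f x.
  by rewrite /f mulr_ge0//; have := ler_norm (- g x); rewrite normrN; lra.
have f1 x : f x <= 1.
  have : g x <= 1 by rewrite gerBl mulr_ge0.
  by rewrite /f; have [h|h] := ger0P (g x); lra.
have fF x : ~ F n x -> f x = 0.
  move=> /negP; rewrite -leNgt => h; rewrite /f ler0_norm; first by ring.
  by rewrite subr_le0 -ler_pdivrMl// mulr1.
have fC x : C x -> f x = 1.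
  move=> Cx; have -> : f x = 2^-1 * (1 + `|1|).
    rewrite /f /g (_ : d x = 0) ?mulr0 ?subr0//.
    apply/eqP; rewrite eq_le d0 andbT -(mdistxx x).
    exact: set_distance_le.
  by rewrite normr1; field.
have E (m : prob R X) : (\int[m]_x f x)%:E = (\int[m]_x (f x)%:E)%E.
  by rewrite fineK//; apply: integrable_fin_num => //; exact: lip1_integrable.
have mf : measurable_fun [set: borel X] (EFin \o (f : borel X -> R)).
  apply/measurable_EFinP.
  exact: continuous_borel_measurable (lip1_continuous lf).
have mC : measurable C := closed_borel cC.

apply: (@le_trans _ _ (\int[nu]_x (f x)%:E)%E).
  rewrite -[C]setIT -integral_indic//; apply: ge0_le_integral => //.
  - exact/measurable_EFinP/measurable_indic.
  - move=> x _; rewrite lee_fin indicE; case: (boolP (x \in C)) => // /[!inE] Cx.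
    by rewrite fC.
rewrite -E nm// E -[F n]setIT -integral_indic//; apply: ge0_le_integral => //.
- by move=> x _; exact: f0.
- exact/measurable_EFinP/measurable_indic.
- move=> x _; rewrite lee_fin indicE; case: (boolP (x \in F n)) => //= h.
  by rewrite fF//; move/negP: h; rewrite inE.
Unshelve. all: by end_near. Qed.

Lemma eq_prob_lip nu mu :
  (forall f, lip1 f -> \int[nu]_x f x = \int[mu]_x f x) -> nu ≡μ mu.
Proof.
move=> nm; have Ec (C : set (borel X)) : closed (C : set X) -> nu C = mu C.
  move=> cC; apply/eqP; rewrite eq_le !le_closed_lip// => f lf.
  exact/esym/nm.
have Eo (U : set (borel X)) : open (U : set X) -> nu U = mu U.
  move=> oU; have mC := measurableC (open_borel oU).
  rewrite -[U]setCK (probability_setC nu mC) (probability_setC mu mC) Ec//.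
  exact: open_closedC.
move=> A mA.
apply: (@g_sigma_algebra_measure_unique _ R (borel X) (@open X) _ (fun=> setT))
  => //.
- exact: open_borel.
- by move=> _; exact: openT.
- by rewrite bigcup_const.
- exact: openI.
- by move=> _; rewrite (le_lt_trans (probability_le1 nu _))// ltry.
Qed.

End lipschitz_determine_measure.

(** * Maximising diversity *)

Lemma expR_tangent {R : realType} (v w : R) : expR w * (1 + (v - w)) <= expR v.
Proof.
have -> : expR v = expR w * expR (v - w) by rewrite -expRD addrC subrK.
by rewrite ler_wpM2l ?expR_ge0// expR_ge1Dx.
Qed.

(** Bernoulli's inequality in exponential form, which will stand in for Jensen's: the tangent at
    [p * v], evaluated at [v] and at 0, with weights [p] and [1 - p]. *)
Lemma expR_mul_le {R : realType} (p v : R) : 0 <= p -> p <= 1 ->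
  expR (p * v) <= 1 + p * (expR v - 1).
Proof.
move=> p0 p1; have := expR_tangent v (p * v); have := expR_tangent 0 (p * v).
by rewrite expR0; set a := expR (p * v); set b := expR v; nra.
Qed.

Lemma expR_mul_ge {R : realType} (p v : R) : p <= 0 ->
  1 + p * (expR v - 1) <= expR (p * v).
Proof.
by move=> p0; have := expR_ge1Dx (p * v); have := expR_ge1Dx v; nra.
Qed.

(** * Comparison of power means *)

Section power_means.
Context {R : realType} {X : pmetricType R}.
Hypothesis cX : compact [set: X].
Variable nu : prob R X.
Implicit Types f g h : X -> R.

Notation lip1 := (lip (@mdist R X)).

Lemma Rintegral1 (a : R) : \int[nu]_x a = a.
Proof.
rewrite Rintegral_cst// -[RHS]mulr1; congr (_ * _).
by rewrite -[RHS]/(fine 1%:E); congr fine; exact: probability_setT.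
Qed.

Lemma lip_ln m g : 0 < m -> (forall x, m <= g x) -> lip1 g ->
  lip1 (fun x => ln (g x)).
Proof.
move=> m0 mg [l l0 lg]; exists (m^-1 * l); first by rewrite mulr_ge0// invr_ge0 ltW.
have g0 x : 0 < g x := lt_le_trans m0 (mg x).
have H x y : ln (g x) - ln (g y) <= m^-1 * l * mdist x y.
  apply: (@le_trans _ _ ((g y)^-1 * (g x - g y))).
    rewrite -ln_div ?posrE// mulrBr mulVf ?gt_eqF//.
    have := expR_ge1Dx (ln (g x / g y)); rewrite lnK ?posrE ?divr_gt0//.
    by rewrite [g x / g y]mulrC; lra.
  apply: (@le_trans _ _ ((g y)^-1 * `|g x - g y|)).
    by rewrite ler_wpM2l ?ler_norm// invr_ge0 ltW.
  rewrite -mulrA ler_pM//; first by rewrite invr_ge0 ltW.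
  by rewrite lef_pV2 ?posrE.
by move=> x y; rewrite ler_norml H andbT lerNl opprB metric_sym H.
Qed.

Lemma le_integral_lip f g : lip1 f -> lip1 g -> (forall x, f x <= g x) ->
  \int[nu]_x f x <= \int[nu]_x g x.
Proof. by move=> lf lg fg; apply: le_Rintegral => //; exact: lip1_integrable. Qed.

Lemma integral_lip_lin (a : R) f g : lip1 f -> lip1 g ->
  \int[nu]_x (a * f x + g x) = a * \int[nu]_x f x + \int[nu]_x g x.
Proof.
move=> lf lg; rewrite RintegralD//; [|exact: lip1_integrable (lipZ a lf)|
  exact: lip1_integrable].
by rewrite RintegralZl//; exact: lip1_integrable.
Qed.

Variables (m : R) (g : X -> R).
Hypotheses (m0 : 0 < m) (mg : forall x, m <= g x) (lg : lip1 g).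

Let g0 x : 0 < g x. Proof. exact: lt_le_trans m0 (mg x). Qed.

Let rho := \int[nu]_x (g x)^-1.

Let lV : lip1 (fun x => (g x)^-1) := lip_inv m0 mg lg.

Lemma harmonic_gt0 : 0 < rho.
Proof.
have [M M0 gM] := lip1_bounded cX lg.
have M1 : 0 < M + 1 by rewrite ltr_wpDl.
apply: (@lt_le_trans _ _ (M + 1)^-1); first by rewrite invr_gt0.
rewrite -[X in X <= _]Rintegral1; apply: le_integral_lip => // [|x].
  exact: lip_cst.
rewrite lef_pV2 ?posrE// (le_trans (ler_norm _))// (le_trans (gM _))//.
by rewrite lerDl.
Qed.

(** [expR (v x)] is [1 / g x] normalised to have integral 1, so that the affine side of Bernoulli's
    inequality integrates to 1 for every [p]. *)
Let v x := - ln (g x) - ln rho.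

Let Ev x : expR (v x) = rho^-1 * (g x)^-1.
Proof.
rewrite /v expRD !expRN !lnK ?posrE//; first exact: mulrC.
exact: harmonic_gt0.
Qed.

Let intEv p : \int[nu]_x (1 + p * (expR (v x) - 1)) = 1.
Proof.
have -> : (fun x => 1 + p * (expR (v x) - 1)) =
    (fun x => (p * rho^-1) * (g x)^-1 + (1 - p)).
  by apply/funext => x; rewrite Ev; ring.
rewrite integral_lip_lin//; last exact: lip_cst.
rewrite Rintegral1 -/rho -mulrA mulVf ?gt_eqF ?harmonic_gt0//; ring.
Qed.

Let lln : lip1 (fun x => ln (g x)) := lip_ln m0 mg lg.

Let lEv p : lip1 (fun x => 1 + p * (expR (v x) - 1)).
Proof.
apply: eq_lip (lipD (lipZ (p * rho^-1) lV) (lip_cst _ (1 - p))) => x.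
by rewrite Ev; ring.
Qed.

Let lEpv p : lip1 (fun x => expR (p * v x)).
Proof.
apply/(lip1_expR cX)/lipZ; apply: lipB; last exact: lip_cst.
exact: lipN.
Qed.

Let intE p : \int[nu]_x expR (- p * ln (g x)) =
  expR (p * ln rho) * \int[nu]_x expR (p * v x).
Proof.
rewrite -RintegralZl//; last exact: lip1_integrable.
by congr (Rintegral nu _ _); apply/funext => x; rewrite -expRD /v; congr expR; ring.
Qed.

(** Here [p] is [1 - q]: this lemma serves the orders below 1, and [power_mean_ge] those above 1. *)
Lemma power_mean_le p : 0 <= p -> p <= 1 ->
  \int[nu]_x expR (- p * ln (g x)) <= expR (p * ln rho).
Proof.
move=> p0 p1; rewrite intE -[X in _ <= X]mulr1 -(intEv p) ler_wpM2l ?expR_ge0//.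
by apply: le_integral_lip => // x; exact: expR_mul_le.
Qed.

Lemma power_mean_ge p : p <= 0 ->
  expR (p * ln rho) <= \int[nu]_x expR (- p * ln (g x)).
Proof.
move=> p0; rewrite intE -[X in X <= _]mulr1 -(intEv p) ler_wpM2l ?expR_ge0//.
by apply: le_integral_lip => // x; exact: expR_mul_ge.
Qed.

Lemma log_mean_le : - (\int[nu]_x ln (g x)) <= ln rho.
Proof.
have lv : lip1 v by apply: lipB; [exact: lipN|exact: lip_cst].
have : \int[nu]_x v x <= 0.
  apply: (@le_trans _ _ (\int[nu]_x (1 + 1 * (expR (v x) - 1) - 1))).
    apply: le_integral_lip => [//||x]; first exact: lipB (lEv 1) (lip_cst _ 1).
    by have := expR_ge1Dx (v x); lra.
  rewrite RintegralB//; [|exact: lip1_integrable|exact: lip1_integrable (lip_cst _ 1)].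
  by rewrite intEv Rintegral1 subrr.
rewrite RintegralB//; [|exact: lip1_integrable (lipN lln)|
  exact: lip1_integrable (lip_cst _ _)].
rewrite Rintegral1 (_ : (fun x => - ln (g x)) = (fun x => -1 * ln (g x))); last first.
  by apply/funext => x; rewrite mulN1r.
by rewrite RintegralZl//; [move=> ?; lra|exact: lip1_integrable].
Qed.

Lemma ess_sup_ge_harmonic :
  (fine (ess_sup nu (fun x => (g x)%:E)))^-1 <= rho.
Proof.
set S := ess_sup _ _.
have nu0 : (0 < nu setT)%E by rewrite probability_setT.
have [M M0 gM] := lip1_bounded cX lg.
have mS : (m%:E <= S)%E.
  by apply: ess_sup_gee => //; apply: nearW => x; rewrite lee_fin.
have SM : (S <= M%:E)%E.
  apply/ess_supP; apply: nearW => x.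
  by rewrite lee_fin (le_trans (ler_norm _))// gM.
have Sfin : S \is a fin_num.
  by rewrite fin_numE; apply/andP; split; apply/eqP => Se; move: mS SM;
    rewrite Se// leeNy_eq.
have s0 : 0 < fine S by rewrite (lt_le_trans m0)// -lee_fin fineK.
rewrite -lee_fin /rho /Rintegral fineK; last first.
  by apply: integrable_fin_num => //; exact: lip1_integrable.
apply: (@le_trans _ _ (\int[nu]_x ((fine S)^-1)%:E)%E).
  rewrite integral_cst// [X in (_ * X)%E](_ : _ = 1%E) ?mule1//.
  exact: probability_setT.
apply: ae_ge0_le_integral => //.
- by move=> x _; rewrite lee_fin invr_ge0 ltW.
- by move=> x _; rewrite lee_fin invr_ge0 ltW.
- apply/measurable_EFinP.
  exact: continuous_borel_measurable (lip1_continuous lV).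
- have : \forall x \ae nu, ((g x)%:E <= S)%E by exact: ess_sup_ge.
  apply: (@filterS _ _ (ae_filter_ringOfSetsType nu)) => x gS _.
  by rewrite lee_fin lef_pV2 ?posrE// -lee_fin fineK.
Qed.

End power_means.

Lemma powR_root_le {R : realType} (A rho p : R) : 0 < rho -> 0 <= A -> 0 < p ->
  A <= expR (p * ln rho) -> A `^ p^-1 <= rho.
Proof.
move=> rho0 A0 p0 h; have -> : rho = (rho `^ p) `^ p^-1.
  by rewrite -powRrM mulfV ?gt_eqF// powRr1// ltW.
apply: ge0_ler_powR; rewrite ?nnegrE ?powR_ge0//; first by rewrite invr_ge0 ltW.
by rewrite /powR gt_eqF.
Qed.

Lemma powR_root_ge {R : realType} (A rho p : R) : 0 < rho -> p < 0 ->
  expR (p * ln rho) <= A -> A `^ p^-1 <= rho.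
Proof.
move=> rho0 p0 h; have A0 : 0 < A := lt_le_trans (expR_gt0 _) h.
rewrite -[p^-1]opprK powRN invf_ple ?posrE ?powR_gt0//.
have -> : rho^-1 = (rho `^ p) `^ (- p^-1).
  by rewrite -powRrM mulrN mulfV ?lt_eqF// powR_inv1// ltW.
apply: ge0_ler_powR; rewrite ?nnegrE ?powR_ge0 ?(ltW A0)//.
  by rewrite oppr_ge0 invr_le0 ltW.
by rewrite /powR gt_eqF.
Qed.

(** * Measures of constant similarity *)

Section diversities.
Context {R : realType} {X : pmetricType R}.
Hypothesis cX : compact [set: X].
Hypothesis nX : negative_type X.
Context (t : R).
Hypothesis t0 : 0 < t.
Implicit Types (nu mu : prob R X) (f g h : X -> R).

Notation lip1 := (lip (@mdist R X)).
Notation K := (@expdist R X t).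
Notation d := (@scaled_dist R X t).
Notation integral nu := (fun h : X -> R => \int[nu]_x h x).

Lemma tame_prob nu : tame 1 (integral nu).
Proof.
have := @tame_integral _ _ cX nu (fun=> 1) (lip_cst _ 1) (fun=> ler01).
rewrite Rintegral1; congr tame; apply/funext => h.
by congr (Rintegral nu _ _); apply/funext => x; rewrite mul1r.
Qed.

Lemma similarityE nu x : similarity d nu x = \int[nu]_y K x y.
Proof. by []. Qed.

Lemma lip_similarity nu : lip1 (similarity d nu).
Proof. exact: (lip_tame_kernel (tame_prob nu) (lip2_expdist cX t)). Qed.

Lemma similarity_lbound : exists2 m : R, 0 < m & forall nu x, m <= similarity d nu x.
Proof.
have [D hD] := diameter cX; exists (expR (- (t * D))); first exact: expR_gt0.
move=> nu x; rewrite similarityE -[X in X <= _](Rintegral1 nu).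
apply: le_integral_lip => // [||y]; [exact: lip_cst|exact: lip1_expdist|].
by rewrite ler_expR lerN2 ler_pM2l.
Qed.

Lemma energy_diff C1 C2 (L1 L2 : (X -> R) -> R) (a : R) (k : X -> X -> R) :
  tame C1 L1 -> tame C2 L2 -> (forall x y, k x y = k y x) ->
  lip dist2 (fun p : X * X => k p.1 p.2) ->
  energy (fun h => L1 h + a * L2 h) k =
  energy L1 k + 2 * a * L1 (fun x => L2 (k x)) + a ^+ 2 * energy L2 k.
Proof.
move=> t1 t2 ks lk; have l1 := lip_tame_kernel t1 lk.
have l2 := lip_tame_kernel t2 lk.
have E C L : tame C L -> L (fun x => L1 (k x) + a * L2 (k x)) =
    L (fun x => L1 (k x)) + a * L (fun x => L2 (k x)).
  by move=> tL; rewrite (tame_D tL)// ?(tame_Z _ tL)//; exact: lipZ.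
rewrite /energy (E _ _ t1) (E _ _ t2) (tame_Fubini t2 t1 lk).
have -> : (fun y => L2 (k^~ y)) = (fun y => L2 (k y)).
  by apply/funext => y; congr L2; apply/funext => x.
ring.
Qed.

(** Nonpositive energy makes the constant density 1 null for [nu - mu]; then all Lipschitz integrals
    against [nu] and [mu] agree. *)
Lemma eq_prob_energy nu mu :
  energy (fun h => \int[nu]_x h x + -1 * \int[mu]_x h x) K <= 0 -> nu ≡μ mu.
Proof.
have tL := tameD (tame_prob nu) (tameZ (-1) (tame_prob mu)).
move=> E0; apply: (eq_prob_lip cX) => f lf.
have l1 : lip1 (fun=> 1) := lip_cst _ 1.
have n1 := energy_null cX nX tL t0 l1.
have /n1 {}n1 : energy (fun h => \int[nu]_x h x + -1 * \int[mu]_x h x)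
    (weighted (fun=> 1) K) <= 0.
  by rewrite (@eq_energy _ _ _ _ K)// => x y; rewrite /weighted !mul1r.
have := null1_eq0 cX nX tL t0 n1 lf.
by rewrite mulN1r => /eqP; rewrite subr_eq0 => /eqP.
Qed.

Section constant_similarity.
Variables (mu : prob R X) (c : R).
Hypothesis muc : forall x, similarity d mu x = c.

Let c0 : 0 < c.
Proof.
by have [m m0 h] := similarity_lbound; rewrite -(muc point) (lt_le_trans m0).
Qed.

Let energy_mu : energy (integral mu) K = c.
Proof.
rewrite -[RHS](Rintegral1 mu); congr (Rintegral mu _ _); exact/funext.
Qed.

Let cross nu : \int[nu]_x \int[mu]_y K x y = c.
Proof.
rewrite -[RHS](Rintegral1 nu); congr (Rintegral nu _ _); exact/funext.
Qed.

(* With [f = 1 / similarity nu] and [rho] its integral, positivity of the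
   energy of [f nu - rho mu] bounds the energy of [f nu] below by [c rho^2],
   and [2 f x f y <= f x ^ 2 + f y ^ 2] bounds it above by [rho]. *)
Lemma harmonic_le nu : \int[nu]_x (similarity d nu x)^-1 <= c^-1.
Proof.
have [m m0 /(_ nu) mg] := similarity_lbound.
set g := similarity d nu in mg *; have lg : lip1 g := lip_similarity nu.
have g0 x : 0 < g x := lt_le_trans m0 (mg x).
pose f x := (g x)^-1; have lf : lip1 f := lip_inv m0 mg lg.
have f0 x : 0 <= f x by rewrite invr_ge0 ltW.
set rho := Rintegral _ _ _.
have rho0 : 0 < rho := harmonic_gt0 cX nu m0 mg lg.
have tN := tame_prob nu; have tM := tame_prob mu.
have tF := tame_integral cX nu lf f0; rewrite -/rho in tF.
have lK := lip2_expdist cX t.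
pose k1 x y := f x * (f y * K x y).
pose k2 x y := f x * f x * K x y; pose k3 x y := f y * f y * K x y.
pose Q := energy (integral nu) k1.
have l1 : lip dist2 (fun p : X * X => k1 p.1 p.2).
  have l0 := @lip2M _ _ cX (fun _ y => f y) _ (lip2_snd lf) lK.
  exact: (@lip2M _ _ cX (fun x _ => f x) (fun x y => f y * K x y) (lip2_fst lf) l0).
have EF : energy (fun h => \int[nu]_x (f x * h x)) K = Q.
  rewrite /Q /energy; congr (Rintegral nu _ _); apply/funext => x.
  by rewrite RintegralZl//; apply: (lip1_integrable cX) => //;
    apply: (lip1M cX) => //; exact: lip1_expdist.
have lower : c * rho ^+ 2 <= Q.
  have tL := tameD tF (tameZ (- rho) tM).
  have : 0 <= energy (fun h => \int[nu]_x (f x * h x) + - rho * \int[mu]_x h x) K.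
    exact: tame_psd tL lK (psd_expdist nX t0).
  rewrite (energy_diff _ tF tM (expdist_sym t) lK) energy_mu EF.
  have -> : \int[nu]_x (f x * \int[mu]_y K x y) = rho * c.
    rewrite -RintegralZr//; last exact: lip1_integrable.
    by congr (Rintegral nu _ _); apply/funext => x; rewrite -(muc x).
  by rewrite sqrrN; lra.
have lf2 : lip1 (fun x => f x * f x) := lip1M cX lf lf.
have l2 : lip dist2 (fun p : X * X => k2 p.1 p.2).
  exact: (@lip2M _ _ cX (fun x _ => f x * f x) _ (lip2_fst lf2) lK).
have l3 : lip dist2 (fun p : X * X => k3 p.1 p.2).
  exact: (@lip2M _ _ cX (fun _ y => f y * f y) _ (lip2_snd lf2) lK).
have l23 : lip dist2 (fun p : X * X => (fun x y => k2 x y + k3 x y) p.1 p.2).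
  exact: lipD l2 l3.
(* Integrating [K] in [y] gives [g x], which cancels one factor [f x]. *)
have Ex : energy (integral nu) k2 = rho.
  congr (Rintegral nu _ _); apply/funext => x.
  rewrite RintegralZl//; last by apply: lip1_integrable => //; exact: lip1_expdist.
  by rewrite -similarityE -/(g x) /f -mulrA mulVf ?mulr1// gt_eqF.
have Ey : energy (integral nu) k3 = rho.
  apply: (etrans (tame_Fubini tN tN l3)); rewrite -[RHS]Ex.
  congr (Rintegral nu _ _); apply/funext => x.
  by congr (Rintegral nu _ _); apply/funext => y; rewrite /k3 expdist_sym.
have upper : Q <= rho.
  have E := @energy_lin _ _ _ _ tN (-2) k1 (fun x y => k2 x y + k3 x y) l1 l23.
  rewrite (energyD tN l2 l3) Ex Ey in E.
  have : 0 <= -2 * Q + (rho + rho).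
    rewrite -E; apply: Rintegral_ge0 => x _; apply: Rintegral_ge0 => y _.
    rewrite /k1 /k2 /k3.
    have := expR_ge0 (- (t * mdist x y)); rewrite -/(K x y).
    move: (f x) (f y) (K x y) => a b k k0.
    have -> : -2 * (a * (b * k)) + (a * a * k + b * b * k) = (a - b) ^+ 2 * k.
      by ring.
    by rewrite mulr_ge0 ?sqr_ge0.
  by move: Q rho {E Ex Ey EF lower rho0 tF} => u v; lra.
rewrite -(ler_pM2l c0) mulfV ?gt_eqF// -(ler_pM2r rho0) mul1r -mulrA -expr2.
exact: le_trans lower upper.
Qed.

Lemma diversity_cst (q : \bar R) : (0 <= q)%E -> diversity d q mu = c^-1.
Proof.
case: q => [r _|_|//] /=; last first.
  rewrite (_ : (fun x => _) = cst c%:E); last by apply/funext => x; rewrite muc.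
  have mu0 : (0 < mu setT)%E by rewrite probability_setT.
  by rewrite (ess_sup_cst _ mu0).
case: ifPn => [_|r1].
  rewrite (_ : (fun x => _) = cst (ln c)); last by apply/funext => x; rewrite muc.
  by rewrite Rintegral1 expRN lnK.
rewrite (_ : (fun x => _) = cst (c `^ (r - 1))); last first.
  by apply/funext => x; rewrite muc.
rewrite Rintegral1 -powRrM -[RHS]powR_inv1 ?(ltW c0)//; congr (c `^ _).
by field; rewrite subr_eq0 eq_sym.
Qed.

Lemma diversity_le (q : \bar R) nu : (0 <= q)%E -> diversity d q nu <= c^-1.
Proof.
move=> q0; apply: le_trans (harmonic_le nu); move: q0.
have [m m0 /(_ nu) mg] := similarity_lbound.
have lg := lip_similarity nu; have g0 x := lt_le_trans m0 (mg x).
have rho0 := harmonic_gt0 cX nu m0 mg lg.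
case: q => [r|_|//] /=; last by rewrite (ess_sup_ge_harmonic cX nu m0).
rewrite lee_fin => r0; case: ifPn => [_|r1].
  rewrite -[leRHS]lnK ?posrE// ler_expR.
  exact: (log_mean_le cX nu m0 mg).
have -> : \int[nu]_x (similarity d nu x `^ (r - 1)) =
    \int[nu]_x expR (- (1 - r) * ln (similarity d nu x)).
  congr (Rintegral nu _ _); apply/funext => x.
  by rewrite /powR gt_eqF// opprB.
have [r_lt1|r_gt1] : r < 1 \/ 1 < r by apply/orP; rewrite -neq_lt.
  have p0 : 0 < 1 - r by lra.
  apply: powR_root_le => //; first by apply: Rintegral_ge0 => x _; exact: expR_ge0.
  by apply: (power_mean_le cX nu m0 mg lg (ltW p0)); lra.
have p0 : 1 - r < 0 by lra.
by apply: powR_root_ge => //; exact: (power_mean_ge cX nu m0 mg lg (ltW p0)).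
Qed.

Lemma maximising_cst : maximising d mu.
Proof. by move=> q q0 nu; rewrite diversity_cst// diversity_le. Qed.

Lemma unique_maximising_cst : unique_maximising d mu.
Proof.
split=> [|nu max_nu]; first exact: maximising_cst.
apply: eq_prob_energy.
rewrite (energy_diff _ (tame_prob nu) (tame_prob mu) (expdist_sym t)
  (lip2_expdist cX t)) energy_mu cross.
have [m m0 /(_ nu) mg] := similarity_lbound.
set E := energy _ _.
have : m <= E.
  rewrite -[X in X <= _](Rintegral1 nu); apply: le_integral_lip => //.
  - exact: lip_cst.
  - exact: lip_similarity.
have q0 : (0 <= 2%:E :> \bar R)%E by rewrite lee_fin.
(* At order 2 the diversity is the inverse of the energy, so maximality reads [E <= c]; the energy
   of [nu - mu] is [E - 2 * c + c]. *)
have := max_nu 2%:E q0 mu; rewrite diversity_cst//= ifF; last first.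
  by rewrite gt_eqF// ltr1n.
have -> : 2 - 1 = 1 :> R by ring.
have -> : \int[nu]_x similarity d nu x `^ 1 = E.
  congr (Rintegral nu _ _); apply/funext => x.
  by rewrite powRr1// (le_trans (ltW m0) (mg x)).
move=> h mE; have E0 : 0 < E := lt_le_trans m0 mE.
have : E <= c.
  move: h; rewrite (_ : (1 - 2)^-1 = -1 :> R); last first.
    by rewrite (_ : 1 - 2 = -1)//; [rewrite invrN1|ring].
  by rewrite powR_inv1 ?(ltW E0)// lef_pV2 ?posrE.
by rewrite sqrrN expr1n; lra.
Qed.

End constant_similarity.

(** The mixed integral of [K] equals [c] in one order and [c'] in the other; so [c = c'] and the
    energy of [nu - mu] is 0. *)
Lemma eq_constant_similarity mu nu c c' :
  (forall x, similarity d mu x = c) -> (forall x, similarity d nu x = c') ->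
  nu ≡μ mu.
Proof.
move=> hc hc'; apply: eq_prob_energy.
have tN := tame_prob nu; have tM := tame_prob mu.
have lK := lip2_expdist cX t.
rewrite (energy_diff _ tN tM (expdist_sym t) lK).
have e1 : energy (integral mu) K = c.
  rewrite -[RHS](Rintegral1 mu); congr (Rintegral mu _ _); exact/funext.
have e2 : energy (integral nu) K = c'.
  rewrite -[RHS](Rintegral1 nu); congr (Rintegral nu _ _); exact/funext.
have e3 : \int[nu]_x \int[mu]_y K x y = c.
  rewrite -[RHS](Rintegral1 nu); congr (Rintegral nu _ _); exact/funext.
have e4 : \int[nu]_x \int[mu]_y K x y = c'.
  rewrite (tame_Fubini tN tM lK) -[RHS](Rintegral1 mu).
  congr (Rintegral mu _ _); apply/funext => y; rewrite -(hc' y) similarityE.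
  by congr (Rintegral nu _ _); apply/funext => x; rewrite expdist_sym.
by rewrite e1 e2 e3 -e4 e3 sqrrN expr1n; lra.
Qed.

End diversities.

(** * Invariant measures *)

Section invariance.
Context {R : realType} {X : pmetricType R}.
Implicit Types (mu : prob R X) (g : X -> X) (f : X -> R).

Notation lip1 := (lip (@mdist R X)).

Lemma isometry_ball g (x : X) (r : R) : self_isometry g ->
  g @^-1` ball (g x) r = ball x r.
Proof. by move=> [_ gd]; apply/seteqP; split=> y; rewrite /= !ballEmdist/= gd. Qed.

Lemma isometry_continuous g : self_isometry g -> continuous g.
Proof.
move=> ig x; apply/cvg_ballP => e e0; apply/nbhs_ballP; exists e => // y.
by rewrite -(isometry_ball _ _ ig).
Qed.

Lemma isometry_measurable g : self_isometry g ->
  measurable_fun [set: borel X] (g : borel X -> borel X).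
Proof.
move=> ig; apply: (@measurability _ _ (borel X) (borel X) setT g (@open X)) => //.
move=> _ [A oA <-].
rewrite setTI; apply: sub_sigma_algebra.
by have /continuousP := isometry_continuous ig; apply.
Qed.

Lemma invariant_integral mu g f : compact [set: X] -> isometry_invariant mu ->
  self_isometry g -> lip1 f -> \int[mu]_x f (g x) = \int[mu]_x f x.
Proof.
move=> cX imu ig lf; have mg := isometry_measurable ig.
have lfg : lip1 (f \o g).
  by case: lf => l l0 lf; exists l => // x y; rewrite (le_trans (lf _ _))// (proj2 ig).
have mf : measurable_fun [set: borel X] (EFin \o (f : borel X -> R)).
  apply/measurable_EFinP.
  exact: continuous_borel_measurable (lip1_continuous lf).
rewrite /Rintegral.
pose gb : borel X -> borel X := g.
have -> : (\int[mu]_x (f (g x))%:E = \int[pushforward mu gb]_x (f x)%:E)%E.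
  rewrite (integral_pushforward mg mf) ?preimage_setT//.
  exact: (lip1_integrable cX _ measurableT lfg).
by congr fine; apply: eq_measure_integral => A mA _; exact: imu.
Qed.

Lemma invariant_similarity (t : R) mu : compact [set: X] -> homogeneous X ->
  isometry_invariant mu ->
  exists c, forall x, similarity (@scaled_dist R X t) mu x = c.
Proof.
move=> cX hX imu; exists (similarity (@scaled_dist R X t) mu point) => x.
have [g ig <-] := hX point x; rewrite !similarityE.
rewrite -(invariant_integral cX imu ig); last exact: lip1_expdist.
by congr (Rintegral mu _ _); apply/funext => y; rewrite /expdist (proj2 ig).
Qed.

Lemma invariant_uniform_haar mu : compact [set: X] -> homogeneous X ->
  negative_type X -> isometry_invariant mu -> is_uniform_measure mu /\ is_haar mu.
Proof.
move=> cX hX nX imu; split.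
  (* The maximising measure is the same at every scale, so the limit is that of a constant
     family. *)
  exists (fun=> mu); split; last exact: (@cvg_cst (weak_star R X)).
  near=> t; have t0 : 0 < t by near: t; exact: nbhs_pinfty_gt.
  have [c muc] := invariant_similarity t cX hX imu.
  exact: unique_maximising_cst muc.
split=> // nu inu; have [c muc] := invariant_similarity 1 cX hX imu.
have [c' nuc] := invariant_similarity 1 cX hX inu.
exact: (eq_constant_similarity cX nX ltr01 muc nuc).
Unshelve. all: by end_near. Qed.

End invariance.

(** * Covering numbers *)

Section covering_numbers.
Context {R : realType} {X : pmetricType R}.
Hypothesis cX : compact [set: X].
Implicit Types (A B : set X) (s : seq X) (e : R).

Definition covers e A s := forall x, A x -> exists2 y, y \in s & mdist y x < e.

Let ex_cover n A : exists k, `[< exists2 s, covers n.+1%:R^-1 A s & size s = k >].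
Proof.
have [|s hs] := @finite_net _ _ cX (n.+1%:R^-1); first by rewrite invr_gt0.
by exists (size s); apply/asboolP; exists s.
Qed.

(** Centres may lie outside [A], which makes the number monotone in [A]. *)
Definition cover_number n A : nat := ex_minn (ex_cover n A).

Lemma cover_numberP n A :
  exists2 s, covers n.+1%:R^-1 A s & size s = cover_number n A.
Proof. by rewrite /cover_number; case: ex_minnP => k /asboolP. Qed.

Lemma cover_number_min n A s : covers n.+1%:R^-1 A s ->
  (cover_number n A <= size s)%N.
Proof.
rewrite /cover_number; case: ex_minnP => k _ h hs; apply: h.
by apply/asboolP; exists s.
Qed.

Lemma le_cover_number n A B : A `<=` B -> (cover_number n A <= cover_number n B)%N.
Proof.
move=> AB; have [s hs <-] := cover_numberP n B.
by apply: cover_number_min => x /AB; exact: hs.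
Qed.

Lemma cover_number0 n : cover_number n set0 = 0%N.
Proof. by apply/eqP; rewrite -leqn0 (@cover_number_min n set0 [::]). Qed.

Lemma cover_numberT_gt0 n : (0 < cover_number n setT)%N.
Proof.
have [s hs <-] := cover_numberP n setT.
by have [y ys _] := hs point I; case: s ys {hs}.
Qed.

Lemma cover_numberU n A B :
  (cover_number n (A `|` B) <= cover_number n A + cover_number n B)%N.
Proof.
have [s hs <-] := cover_numberP n A; have [r hr <-] := cover_numberP n B.
rewrite -size_cat; apply: cover_number_min => x [/hs|/hr] [y ys yx];
  by exists y => //; rewrite mem_cat ys ?orbT.
Qed.

(** No open ball of radius [n.+1%:R^-1] meets both sets, so an optimal cover of the union splits
    into a cover of each. *)
Lemma cover_number_separated n A B :
  (forall a b, A a -> B b -> 2 * n.+1%:R^-1 <= mdist a b) ->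
  (cover_number n A + cover_number n B <= cover_number n (A `|` B))%N.
Proof.
move=> sep; have [s hs <-] := cover_numberP n (A `|` B).
pose P (C : set X) y := `[< exists2 x, C x & mdist y x < n.+1%:R^-1 >].
have bound C : C `<=` A `|` B -> (cover_number n C <= count (P C) s)%N.
  move=> CAB; rewrite -size_filter; apply: cover_number_min => x Cx.
  have [y ys yx] := hs x (CAB x Cx); exists y => //.
  by rewrite mem_filter ys andbT; apply/asboolP; exists x.
have -> : size s = (count (predT : pred X) s) by rewrite count_predT.
apply: (@leq_trans (count (P A) s + count (P B) s)).
  by apply: leq_add; apply: bound; [exact: subsetUl|exact: subsetUr].
rewrite -count_predUI (_ : count (predI _ _) s = 0%N); last first.
  apply/eqP; rewrite -leqn0 -ltnS ltnS leqNgt -has_count; apply/hasPn => y _ /=.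
  apply/negP => /andP[/asboolP[a Aa ya] /asboolP[b Bb yb]].
  have := sep a b Aa Bb; rewrite leNgt => /negP; apply.
  rewrite (le_lt_trans (metric_triangle a y b))// mulrDl mul1r ltrD//.
  by rewrite metric_sym.
by rewrite addn0; apply: sub_count.
Qed.

Lemma cover_number_isometry n A g : self_isometry g ->
  (cover_number n (g @^-1` A) <= cover_number n A)%N.
Proof.
move=> [[h hg gh] gd]; have [s hs <-] := cover_numberP n A.
rewrite -(size_map h); apply: cover_number_min => x /hs[y ys yx].
by exists (h y); [exact: map_f|rewrite -gd gh].
Qed.

End covering_numbers.

(** Compactness gives a cluster point; it is a limit because an ultrafilter contains each set or its
    complement. *)
Lemma ultra_cvg_itv {R : realType} {T : Type} (U : set_system T) (f : T -> R) a b :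
  UltraFilter U -> (forall x, a <= f x <= b) -> exists l : R, f @ U --> l.
Proof.
move=> UU fab; have FF : ProperFilter (f @ U) by exact: fmap_proper_filter.
have [l [_ cl]] : `[a, b]%classic `&` cluster (f @ U) !=set0.
  apply: (segment_compact FF); rewrite /fmap/=; apply: filterE => x.
  by rewrite /= in_itv/= fab.
exists l => A lA; have [//|h] := in_ultra_setVsetC (f @^-1` A) UU.
by have [y [/= nAy Ay]] := cl (~` A) A h lA.
Qed.

(** * An invariant content *)

Section content.
Context {R : realType} {X : pmetricType R}.
Hypothesis cX : compact [set: X].

(* The ultrafilter limit makes the covering ratios simultaneously converge, so
   that both subadditivity and superadditivity survive. *)
Lemma ex_invariant_content : exists lam : set X -> R,
  [/\ lam set0 = 0, lam setT = 1, forall A B, A `<=` B -> lam A <= lam B &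
      forall A B, lam (A `|` B) <= lam A + lam B] /\
  [/\ forall A B e, 0 < e -> (forall a b, A a -> B b -> e <= mdist a b) ->
        lam A + lam B <= lam (A `|` B) &
      forall g A, self_isometry g -> lam (g @^-1` A) <= lam A].
Proof.
pose N n A := cover_number cX n A.
pose ratio A n : R := (N n A)%:R / (N n setT)%:R.
have NT0 n : 0 < (N n setT)%:R :> R by rewrite ltr0n cover_numberT_gt0.
have [U [UU ooU]] := @ultraFilterLemma nat (nbhs \oo) _.
have PU : ProperFilter U by exact: ultra_proper.
have ratio01 A n : 0 <= ratio A n <= 1.
  rewrite divr_ge0//= ler_pdivrMr// mul1r ler_nat; exact: le_cover_number.
have /choice[lam hlam] : forall A, exists l : R, ratio A @ U --> l.
  by move=> A; exact: (ultra_cvg_itv UU (ratio01 A)).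
have le_lam (f g : nat -> R) a b : f @ U --> a -> g @ U --> b ->
    (forall n, f n <= g n) -> a <= b.
  by move=> fa gb fg; apply: (ler_cvg_to fa gb); exact: nearW.
have lamC A (c : R) : (forall n, ratio A n = c) -> lam A = c.
  move=> h; apply/eqP; rewrite eq_le; apply/andP; split.
    by apply: (le_lam _ _ _ _ (hlam A) (cvg_cst c)) => n; rewrite h.
  by apply: (le_lam _ _ _ _ (cvg_cst c) (hlam A)) => n; rewrite h.
exists lam; split; split.
- by apply: lamC => n; rewrite /ratio /N cover_number0 mul0r.
- by apply: lamC => n; rewrite /ratio divff// gt_eqF.
- move=> A B AB; apply: (le_lam _ _ _ _ (hlam A) (hlam B)) => n.
  by rewrite ler_pM2r ?invr_gt0// ler_nat le_cover_number.
- move=> A B; apply: (le_lam _ _ _ _ (hlam _) (cvgD (hlam A) (hlam B))) => n.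
  rewrite [leRHS](_ : _ = (N n A + N n B)%:R / (N n setT)%:R).
    by rewrite ler_pM2r ?invr_gt0// ler_nat cover_numberU.
  by rewrite natrD mulrDl.
- move=> A B e e0 sep.
  apply: (ler_cvg_to (cvgD (hlam A) (hlam B)) (hlam (A `|` B))).
  (* [U] refines the filter at infinity, hence contains the set of scales fine enough to see the
     separation [e]. *)
  apply: (filterS _ (ooU _ (_ : nbhs \oo [set n | 2 * n.+1%:R^-1 <= e]))).
    move=> n /= ne; rewrite [leLHS](_ : _ = (N n A + N n B)%:R / (N n setT)%:R);
      last by rewrite natrD mulrDl.
    rewrite ler_pM2r ?invr_gt0// ler_nat.
    by apply: cover_number_separated => a b Aa Bb; rewrite (le_trans ne)// sep.
  exists (Num.trunc (2 / e)) => // n /= hn.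
  rewrite ler_pdivrMr// -ler_pdivrMl// mulrC ltW//.
  by rewrite (lt_le_trans (truncnS_gt _))// ler_nat ltnS.
- move=> g A ig; apply: (le_lam _ _ _ _ (hlam _) (hlam A)) => n.
  by rewrite ler_pM2r ?invr_gt0// ler_nat cover_number_isometry.
Qed.

End content.

(** * From the content to a Borel measure *)

Section measure_of_content.
Context {R : realType} {X : pmetricType R}.
Hypothesis cX : compact [set: X].
Variable lam : set X -> R.
Hypothesis lam0 : lam set0 = 0.
Hypothesis lamT : lam setT = 1.
Hypothesis le_lam : forall A B, A `<=` B -> lam A <= lam B.
Hypothesis lamU : forall A B, lam (A `|` B) <= lam A + lam B.
Hypothesis lam_separated : forall A B e, 0 < e ->
  (forall a b, A a -> B b -> e <= mdist a b) -> lam A + lam B <= lam (A `|` B).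
Local Open Scope ereal_scope.
Implicit Types A B E U V : set X.

(** The uniform margin supplies the positive distance that [lam_separated] requires. *)
Definition well_inside A U :=
  exists2 e : R, (0 < e)%R & forall x, A x -> ball x e `<=` U.

Definition inner U := ereal_sup [set (lam A)%:E | A in [set A | well_inside A U]].

(** The value [+oo] leaves only covers by open sets to compete in [mu_ext]. *)
Definition open_weight U : \bar R := if `[< open U >] then inner U else +oo.

(* All sets are measurable in this copy of X, so [mu_ext] takes the infimum over
   arbitrary countable covers. *)
Let T := g_sigma_algebraType [set: set X].

Definition outer := mu_ext (open_weight : set T -> \bar R).

Let mT (A : set T) : measurable A.
Proof. exact: sub_sigma_algebra. Qed.

Lemma well_inside0 U : well_inside set0 U.
Proof. by exists 1%R. Qed.

Lemma inner_ge A U : well_inside A U -> (lam A)%:E <= inner U.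
Proof. by move=> AU; apply: ereal_sup_ubound; exists A. Qed.

Lemma inner_ge0 U : 0 <= inner U.
Proof. by rewrite -[leLHS]/(0%:E) -lam0; apply: inner_ge; exact: well_inside0. Qed.

Lemma inner_le1 U : inner U <= 1.
Proof.
by apply: ge_ereal_sup => _ [A _ <-]; rewrite lee_fin -lamT le_lam.
Qed.

Lemma open_weight_open U : open U -> open_weight U = inner U.
Proof. by move=> oU; rewrite /open_weight; case: asboolP. Qed.

Lemma open_weight_ge0 U : 0 <= open_weight U.
Proof. by rewrite /open_weight; case: ifP => _; [exact: inner_ge0|]. Qed.

Lemma open_weight0 : open_weight set0 = 0.
Proof.
rewrite open_weight_open; last exact: open0.
apply/eqP; rewrite eq_le inner_ge0 andbT; apply: ge_ereal_sup => _ [A [e e0 A0] <-].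
rewrite lee_fin -lam0 le_lam// => x /A0; apply.
by rewrite ballEmdist/= mdistxx.
Qed.

Definition outer_measure_of_content : {outer_measure set X -> \bar R} :=
  HB.pack (outer : set X -> \bar R)
   (isOuterMeasure.Build R X outer
     (@mu_ext0 _ T R open_weight open_weight0 open_weight_ge0)
     (@mu_ext_ge0 _ T R open_weight open_weight_ge0)
     (@le_mu_ext _ T R open_weight)
     (@mu_ext_sigma_subadditive _ T R open_weight open_weight_ge0)).

Lemma outer_ge0 E : 0 <= outer E.
Proof. exact: (@mu_ext_ge0 _ T R open_weight open_weight_ge0). Qed.

Lemma outer_le_cover E (F : (set X)^nat) : E `<=` \bigcup_k F k ->
  outer E <= \sum_(k <oo) open_weight (F k).
Proof. by move=> EF; apply: ereal_inf_lbound; exists F. Qed.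

Lemma outer_le E V : E `<=` V -> outer E <= open_weight V.
Proof.
move=> EV; pose F k := if k is 0%N then V else set0.
have -> : open_weight V = \sum_(k <oo) open_weight (F k).
  rewrite nneseries_recl//; last by move=> *; exact: open_weight_ge0.
  rewrite eseries_cond/= eseries0 ?adde0// => -[|]//= k _ _.
  exact: open_weight0.
by apply: outer_le_cover => x /EV Vx; exists 0%N.
Qed.

(** Take [A] well inside [V] and [U]. Its margin keeps [closure A] off the complement of [U], so
    [V'] is an open set covering the rest of [V]; any [L] well inside [V'] is separated from [A],
    and [lam] adds up. Suprema over [L] and [A] conclude. *)
Lemma open_weight_split U V : open U ->
  open_weight (V `&` U) + outer (V `\` U) <= open_weight V.
Proof.
move=> oU; rewrite [leRHS]/open_weight; case: asboolP => [oV|_]; last exact: leey.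
rewrite open_weight_open; last exact: openI.
have fin : outer (V `\` U) \is a fin_num.
  rewrite ge0_fin_numE; last exact: outer_ge0.
  apply: (le_lt_trans (outer_le (@subDsetl _ V U))).
  by rewrite open_weight_open// (le_lt_trans (inner_le1 _))// ltry.
rewrite -leeBrDr//; apply: ge_ereal_sup => _ [A [e e0 Ae] <-].
rewrite leeBrDr// addrC -leeBrDr//.
pose V' := V `\` closure A.
have oV' : open V'.
  by rewrite /V' setDE; apply: openI => //; exact/closed_openC/closed_closure.
have VU : V `\` U `<=` V'.
  move=> x [Vx nUx]; split=> // clA; apply: nUx.
  have [y [Ay]] := clA _ (nbhsx_ballx x e e0).
  rewrite ballEmdist/= => xy; apply: (proj2 (Ae y Ay x _)).
  by rewrite ballEmdist/= metric_sym.
apply: (le_trans (outer_le VU)); rewrite open_weight_open//.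
apply: ge_ereal_sup => _ [L [r r0 Lr] <-]; rewrite leeBrDr//.
rewrite -EFinD.
apply: (@le_trans _ _ (lam (A `|` L))%:E).
  rewrite lee_fin addrC; apply: (lam_separated r0) => a b Aa Lb.
  rewrite leNgt; apply/negP => ab.
  have [_] : V' a by apply: (Lr b Lb); rewrite ballEmdist/= metric_sym.
  by apply; exact: subset_closure.
apply: inner_ge; exists (Num.min e r); first by rewrite lt_min e0.
move=> x [Ax|Lx] y; rewrite ballEmdist/= lt_min => /andP[xe xr].
  by apply: (proj1 (Ae x Ax y _)); rewrite ballEmdist.
by have [] : V' y by apply: (Lr x Lx); rewrite ballEmdist.
Qed.

Lemma open_caratheodory U : open U ->
  outer_measure_of_content.-caratheodory U.
Proof.
move=> oU; apply: le_caratheodory_measurable => E /=.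
apply: le_ereal_inf_tmp => _ [F [_ EF] <-].
apply: (@le_trans _ _ (\sum_(k <oo) (open_weight (F k `&` U) + outer (F k `\` U)))).
  rewrite nneseriesD; last 2 first.
  - by move=> *; exact: open_weight_ge0.
  - by move=> *; exact: outer_ge0.
  apply: leeD.
    apply: outer_le_cover => x [/EF[k _ Fx] Ux]; by exists k.
  apply: (@le_trans _ _ (outer (\bigcup_k (F k `\` U)))).
    by apply: (@le_mu_ext _ T R open_weight) => x [/EF[k _ Fx] Ux]; exists k.
  exact: (@mu_ext_sigma_subadditive _ T R open_weight open_weight_ge0).
apply: lee_nneseries => [k _ _|k _].
  by rewrite adde_ge0 ?open_weight_ge0//; exact: outer_ge0.
exact: open_weight_split.
Qed.

Lemma lam_bigcup (F : (set X)^nat) n :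
  (lam (\bigcup_(k < n) F k) <= \sum_(k < n) lam (F k))%R.
Proof.
elim: n => [|n IH].
  by rewrite big_ord0 bigcup_mkord big_ord0 lam0.
rewrite big_ord_recr/= bigcup_mkord big_ord_recr/= -bigcup_mkord.
by rewrite (le_trans (lamU _ _))// lerD2r.
Qed.

(** A form of Lebesgue's number lemma: the same [n] bounds the number of sets and gives the margin
    by which they shrink, so that in [outerT] the finite subadditivity of [lam] applies to sets well
    inside the [F k]. *)
Lemma open_cover_bound (F : (set X)^nat) : (forall k, open (F k)) ->
  setT `<=` \bigcup_k F k ->
  exists n, setT `<=` \bigcup_(k < n) [set x | ball x n.+1%:R^-1 `<=` F k].
Proof.
move=> oF FT; pose P n x := exists2 k, (k < n)%N & ball x n.+1%:R^-1 `<=` F k.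
have /compact_near_coveringP/(_ nat \oo P _)[|n _ hn] := cX; last first.
  by exists n => x _; have [k kn hk] := hn n (leqnn n) x I; exists k.
move=> x _; have [k _ Fx] := FT x I.
have /nbhs_ballP[e /= e0 he] : nbhs x (F k) by apply: open_nbhs_nbhs.
have e20 : (0 < e / 2)%R by rewrite divr_gt0.
near=> y n => /=; exists k; first by near: n; exists k.+1.
move=> z; rewrite ballEmdist/= => yz; apply: he; rewrite ballEmdist/=.
rewrite (le_lt_trans (metric_triangle _ y _))// [e]splitr ltrD//.
  have : ball x (e / 2) y by near: y; exact: nbhsx_ballx.
  by rewrite ballEmdist.
rewrite (lt_le_trans yz)//; near: n.
exists (Num.trunc (2 / e)) => // n /= hn.
rewrite -[leRHS]invrK lef_pV2 ?posrE ?invr_gt0// invf_div ltW//.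
by rewrite (lt_le_trans (truncnS_gt _))// ler_nat ltnS.
Unshelve. all: by end_near. Qed.

Lemma outerT : outer setT = 1.
Proof.
apply/eqP; rewrite eq_le; apply/andP; split.
  rewrite (le_trans (outer_le (@subset_refl _ setT)))//.
  by rewrite open_weight_open ?inner_le1//; exact: openT.
apply: le_ereal_inf_tmp => _ [F [_ FT] <-].
have [oF|] := pselect (forall k, open (F k : set X)); last first.
  move=> /existsNP[k nk]; rewrite (@eseries_pinfty _ _ _ k) ?leey//.
    by move=> n _; rewrite gt_eqF// (lt_le_trans _ (open_weight_ge0 _))// ltNye.
  by rewrite /open_weight; case: asboolP.
have [n hn] := open_cover_bound oF FT.
apply: (le_trans _ (nneseries_lim_ge n _)); last first.
  by move=> *; exact: open_weight_ge0.
rewrite big_mkord.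
apply: (@le_trans _ _ (\sum_(k < n) (lam [set x | ball x n.+1%:R^-1 `<=` F k])%:E)).
  rewrite sumEFin lee_fin -[leLHS]lamT.
  apply: le_trans (lam_bigcup (fun k => [set x | ball x n.+1%:R^-1 `<=` F k]) n).
  exact: le_lam.
apply: lee_sum => k _; rewrite open_weight_open//; apply: inner_ge.
by exists n.+1%:R^-1%R; rewrite ?invr_gt0.
Qed.

Lemma outer_isometry g E : (forall A, lam (g @^-1` A) <= lam A)%R ->
  self_isometry g -> outer (g @^-1` E) <= outer E.
Proof.
move=> lamg ig; apply: le_ereal_inf_tmp => _ [F [_ EF] <-].
apply: (@le_trans _ _ (\sum_(k <oo) open_weight (g @^-1` F k))).
  by apply: outer_le_cover => x /EF[k _ Fx]; exists k.
apply: lee_nneseries => [k _ _|k _]; first exact: open_weight_ge0.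
rewrite [leRHS]/open_weight; case: asboolP => [oF|_]; last exact: leey.
rewrite open_weight_open; last first.
  by have /continuousP := isometry_continuous ig; exact.
have [[h hg gh] gd] := ig.
apply: ge_ereal_sup => _ [A [e e0 Ae] <-].
(* The preimage of [A] under the inverse [h] is its image under [g], which is well inside [F k]. *)
apply: (@le_trans _ _ (lam (h @^-1` A))%:E).
  rewrite lee_fin (le_trans _ (lamg _))// le_lam// => x.
  by rewrite /preimage/= hg.
apply: inner_ge; exists e => // x Ax y.
rewrite ballEmdist/= => xy; have := Ae (h x) Ax (h y).
by rewrite ballEmdist/= -gd !gh => /(_ xy).
Qed.

End measure_of_content.

Lemma ex_invariant_probability {R : realType} {X : pmetricType R} :
  compact [set: X] -> exists mu : prob R X, isometry_invariant mu.
Proof.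
move=> cX; have [lam [[lam0 lamT le_lam lamU] [lam_sep lam_iso]]] :=
  ex_invariant_content cX.
pose m := outer_measure_of_content lam0 le_lam.
have sub : <<s @open X >> `<=` m.-caratheodory.
  apply: smallest_sub; first exact: (sigma_algebra_measurable (caratheodory_type m)).
  by move=> U oU; apply: open_caratheodory.
pose P : set (borel X) -> \bar R := outer lam.
have Psa : semi_sigma_additive P.
  move=> F mF tF mUF.
  exact: (@caratheodory_measure_sigma_additive R X m F (fun n => sub _ (mF n)) tF
    (sub _ mUF)).
have P0 : P set0 = 0%E by exact: outer_measure0 m.
have Pge0 A : (0 <= P A)%E by exact: outer_ge0.
have PT : P setT = 1%E by exact: outerT.
pose M : {measure set (borel X) -> \bar R} :=
  HB.pack P (isMeasure.Build _ (borel X) R P P0 Pge0 Psa).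
pose mu : prob R X :=
  HB.pack P (Measure.class M) (Measure_isProbability.Build _ (borel X) R M PT).
exists mu => g ig A mA; change (outer lam (g @^-1` A) = outer lam A).
have iso_le h E : self_isometry h -> (outer lam (h @^-1` E) <= outer lam E)%E.
  by move=> ih; apply: outer_isometry => // B; exact: lam_iso.
apply/eqP; rewrite eq_le iso_le//=.
(* The reverse inequality is the same one for the inverse isometry. *)
have [[h hg gh] gd] := ig.
have ih : self_isometry h.
  by split; [exists g|move=> x y; rewrite -gd !gh].
have {1}-> : A = h @^-1` (g @^-1` A).
  by apply/seteqP; split=> x; rewrite /preimage/= gh.
exact: iso_le.
Qed.

Theorem proposition9p5 (R : realType) (X : pmetricType R)
    (cX : compact [set: X]) (hX : homogeneous X) (nX : negative_type X) :
  exists mu : prob R X, is_uniform_measure mu /\ is_haar mu.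
Proof.
have [mu imu] := ex_invariant_probability cX.
by exists mu; exact: invariant_uniform_haar.
Qed.
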